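(* There are exactly $54$ diffeomorphism classes of $5$-dimensional real Bott manifolds; that is, the set of manifolds $M(A)$, where $A$ ranges over all Bott matrices of size $5$, falls into exactly $54$ diffeomorphism classes.
   Context: A Bott matrix of size $n$ is an $n\times n$ upper triangular matrix $A=(a_{ij})$ with $a_{ii}=1$ for all $i$ and $a_{ij}\in\{0,1\}$ for $i<j$. Let $S^1\subset\mathbb{C}$ be the unit circle and $T^n=(S^1)^n$. A Bott matrix $A$ defines a free action of $(\mathbb{Z}_2)^n=\langle g_1,\dots,g_n\rangle$ on $T^n$ by $$g_i(z_1,\dots,z_n)=(z_1,\dots,z_{i-1},-z_i,\tilde z_{i+1},\dots,\tilde z_n),$$ where for $j>i$, $\tilde z_j=\bar z_j$ if $a_{ij}=1$ and $\tilde z_j=z_j$ if $a_{ij}=0$. The quotient smooth manifold $M(A)=T^n/(\mathbb{Z}_2)^n$ is called an ($n$-dimensional) real Bott manifold. *)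

(* Defs.v *)
From HB Require Import structures.
From mathcomp Require Import all_boot all_order all_algebra.
From mathcomp Require Import generic_quotient complex zify ring lra.
From mathcomp Require Import all_classical all_reals all_analysis.

Set Implicit Arguments.
Unset Strict Implicit.
Unset Printing Implicit Defensive.

Import Order.TTheory GRing.Theory Num.Theory numFieldNormedType.Exports.

Local Open Scope classical_set_scope.
Local Open Scope ring_scope.
Local Open Scope quotient_scope.

Section SmoothMaps.
Context {R : realType}.

(* The delta_mx 0 i are the vectors of the canonical basis. *)
Fixpoint Ck (k : nat) (m n : nat) (U : set 'rV[R]_m)
    (f : 'rV[R]_m -> 'rV[R]_n) : Prop :=
  (forall x, U x -> {for x, continuous f}) /\
  (if k is k'.+1 then
     forall i : 'I_m, (forall x, U x -> derivable f x (delta_mx 0 i)) /\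
                      Ck k' U ('D_(delta_mx 0 i) f)
   else True).

Definition smooth_on (m n : nat) (U : set 'rV[R]_m)
    (f : 'rV[R]_m -> 'rV[R]_n) : Prop := forall k, Ck k U f.

(* Smooth structures are given by local parametrizations (inverses of charts),
   from open subsets of R^m to M; pmap is only relevant on pdom. *)
Record param (m : nat) (M : Type) := Param {
  pdom : set 'rV[R]_m ;
  pmap : 'rV[R]_m -> M }.

Definition smooth_in (m n : nat) (M N : Type)
    (phi : param m M) (psi : param n N) (f : M -> N) : Prop :=
  let W := pdom phi `&` [set x | (pmap psi @` pdom psi) (f (pmap phi x))] in
  open W /\
  exists2 h : 'rV[R]_m -> 'rV[R]_n, smooth_on W h &
    forall x, W x -> pdom psi (h x) /\ pmap psi (h x) = f (pmap phi x).

(* The topology of a manifold is the one for which the parametrizations are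
   homeomorphisms onto open subsets; the Hausdorff and countability axioms,
   which play no role in the notion of diffeomorphism, are not included. *)
Record smoothManifold (m : nat) := SmoothManifold {
  points :> Type ;
  atlas : set (param m points) ;
  atlas_open : forall phi, atlas phi -> open (pdom phi) ;
  atlas_inj : forall phi, atlas phi -> set_inj (pdom phi) (pmap phi) ;
  atlas_cover : forall p : points,
    exists2 phi, atlas phi & (pmap phi @` pdom phi) p ;
  atlas_compat : forall phi psi, atlas phi -> atlas psi ->
    smooth_in phi psi id }.

Definition smooth_map (m n : nat) (M : smoothManifold m) (N : smoothManifold n)
    (f : M -> N) : Prop :=
  forall phi psi, atlas phi -> atlas psi -> smooth_in phi psi f.

Definition diffeomorphic (m n : nat)
    (M : smoothManifold m) (N : smoothManifold n) : Prop :=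
  exists (f : M -> N) (g : N -> M),
    [/\ cancel f g, cancel g f, smooth_map f & smooth_map g].

Lemma near_continuous (m n : nat) (f g : 'rV[R]_m -> 'rV[R]_n) x :
  (\forall y \near x, f y = g y) -> {for x, continuous g} ->
  {for x, continuous f}.
Proof.
move=> fg gC; have fgx := nbhs_singleton fg.
change (f @ x --> f x); rewrite fgx.
have gf : \forall y \near x, g y = f y by apply: filterS fg => y /esym.
exact: cvg_trans (near_eq_cvg gf) gC.
Qed.

Lemma Ck_local (k m n : nat) (U : set 'rV[R]_m) (f : 'rV[R]_m -> 'rV[R]_n) :
  (forall x, U x -> exists g, (\forall y \near x, f y = g y) /\ Ck k setT g) ->
  Ck k U f.
Proof.
elim: k f U => [|k IH] f U H.
  split=> // x /H [g [fg [gC _]]].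
  exact: near_continuous fg (gC x I).
split.
  move=> x /H [g [fg [gC _]]].
  exact: near_continuous fg (gC x I).
have ne0 i : (delta_mx 0 i : 'rV[R]_m) != 0.
  apply/eqP => /matrixP /(_ 0 i); rewrite !mxE !eqxx /= => /eqP.
  by rewrite oner_eq0.
move=> i; split.
  move=> x /H [g [fg [_ /(_ i) [gD _]]]].
  apply: near_eq_derivable (gD x I) => //.
  by near=> y; apply/esym; near: y.
apply: IH => x /H [g [fg [_ /(_ i) [gD gk]]]].
exists ('D_(delta_mx 0 i) g); split => //.
apply: filterS (nbhs_interior fg) => y fgy.
exact: near_eq_derive.
Unshelve. all: by end_near. Qed.

Lemma Ck_cst (k m n : nat) (U : set 'rV[R]_m) (c : 'rV[R]_n) :
  Ck k U (fun=> c).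
Proof.
elim: k c => [|k IH] c; split=> //; try by move=> x _; exact: cst_continuous.
move=> i; split.
  by move=> x _; exact: (@derivable_cst R _ _ c x (delta_mx 0 i)).
rewrite (_ : 'D_(delta_mx 0 i) _ = fun=> (0 : 'rV[R]_n)); last first.
  by apply/funext => x; rewrite derive_cst.
exact: IH.
Qed.

Definition diag_affine (n : nat) (s c x : 'rV[R]_n) : 'rV[R]_n :=
  \row_j (s 0 j * x 0 j + c 0 j).

Lemma diag_affine_continuous (n : nat) (s c : 'rV[R]_n) :
  (forall j, `|s 0 j| = 1) -> continuous (diag_affine s c).
Proof.
move=> s1 x B /nbhs_ballP [e e0 eB].
apply/nbhs_ballP; exists e => // y [_ xy]; apply: eB; split=> // i j.
have {xy} := xy i j; rewrite !mxE !ord1 /ball /=.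
by rewrite opprD addrACA subrr addr0 -mulrBr normrM s1 mul1r.
Qed.

Lemma Ck_diag_affine (k n : nat) (s c : 'rV[R]_n) :
  (forall j, `|s 0 j| = 1) -> Ck k setT (diag_affine s c).
Proof.
move=> s1; case: k => [|k]; split; try by move=> x _; exact: diag_affine_continuous.
  by [].
have dE v x : is_derive x v (diag_affine s c) (\row_j (s 0 j * v 0 j)).
  have H : (fun h => h^-1 *: ((diag_affine s c \o shift x) (h *: v) -
      diag_affine s c x)) @ 0^' --> (\row_j (s 0 j * v 0 j) : 'rV[R]_n).
    apply: cvg_near_cst; near=> h.
    have h0 : h != 0 by near: h; exact: nbhs_dnbhs_neq.
    by apply/rowP => j; rewrite !mxE; field.
  apply: DeriveDef; first by apply/cvg_ex; exists (\row_j (s 0 j * v 0 j)).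
  exact: cvg_lim H.
move=> i; split=> [x _|]; first exact: ex_derive.
rewrite (_ : 'D_(delta_mx 0 i) _ =
  fun=> \row_j (s 0 j * (delta_mx 0 i : 'rV[R]_n) 0 j)); last first.
  by apply/funext => x; apply: derive_val.
exact: Ck_cst.
Unshelve. all: by end_near. Qed.

End SmoothMaps.

Definition bott_matrix (n : nat) (A : 'M[bool]_n) : bool :=
  [forall i, A i i] && [forall i : 'I_n, forall j : 'I_n, (j < i)%N ==> ~~ A i j].

Section Torus.
Context {R : realType}.

Definition circle := {z : R[i] | `|z| == 1}.

Fact circle_opp_subproof (z : circle) : `|- val z| == 1.
Proof. by rewrite normrN (valP z). Qed.

Fact circle_conj_subproof (z : circle) : `|(val z)^*| == 1.
Proof. by rewrite norm_conjC (valP z). Qed.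

Definition circle_opp (z : circle) : circle := Sub (- val z) (circle_opp_subproof z).
Definition circle_conj (z : circle) : circle :=
  Sub ((val z)^*) (circle_conj_subproof z).

Fact expi_subproof (t : R) : `|(cos t +i* sin t)%C| == 1.
Proof.
rewrite normc_def /= cos2Dsin2 sqrtr1; exact/eqP.
Qed.

Definition expi (t : R) : circle := Sub (cos t +i* sin t)%C (expi_subproof t).

Lemma cosD2pin (k : int) (t : R) : cos (t + k%:~R * (pi *+ 2)) = cos t.
Proof.
case: (intP k) t => [|{}k|{}k] t; first by rewrite mul0r addr0.
  by rewrite -pmulrn mulr_natl (periodicn (@cosD2pi R)).
rewrite -[in RHS](subrK (pi *+ 2 *+ k.+1) t) (periodicn (@cosD2pi R)).
by rewrite mulrNz mulNr -pmulrn mulr_natl.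
Qed.

Lemma sinD2pin (k : int) (t : R) : sin (t + k%:~R * (pi *+ 2)) = sin t.
Proof.
case: (intP k) t => [|{}k|{}k] t; first by rewrite mul0r addr0.
  by rewrite -pmulrn mulr_natl (periodicn (@sinD2pi R)).
rewrite -[in RHS](subrK (pi *+ 2 *+ k.+1) t) (periodicn (@sinD2pi R)).
by rewrite mulrNz mulNr -pmulrn mulr_natl.
Qed.

Lemma cos_eq1 (t : R) : cos t = 1 -> exists k : int, t = k%:~R * (pi *+ 2).
Proof.
move=> t1; pose k := Num.floor (t / (pi *+ 2)); exists k.
have p0 : 0 < pi *+ 2 :> R by rewrite mulrn_wgt0 // pi_gt0.
pose u := t + (- k)%:~R * (pi *+ 2).
have u1 : cos u = 1 by rewrite cosD2pin.
have u0 : 0 <= u.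
  by rewrite /u mulrNz mulNr subr_ge0 -ler_pdivlMr // floor_le.
have u2 : u < pi *+ 2.
  rewrite /u mulrNz mulNr ltrBlDl -[X in _ + X]mul1r -mulrDl.
  by rewrite -ltr_pdivrMr // -intrD1 floorD1_gt.
suff : u = 0 by move/eqP; rewrite /u mulrNz mulNr subr_eq0 => /eqP.
have pi0 := pi_ge0 R.
have [upi|upi] := leP u pi.
  by apply: cos_inj; rewrite ?in_itv /= ?lexx ?u0 ?upi ?pi0 // cos0.
suff /eqP : pi *+ 2 - u = 0 by rewrite subr_eq0 => /eqP E; rewrite E ltxx in u2.
apply: cos_inj; rewrite ?in_itv /= ?lexx ?pi0 //.
  by rewrite subr_ge0 ltW //= lerBlDr mulr2n lerD2l ltW.
by rewrite cos0 addrC cosD2pi cosN.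
Qed.

Lemma expi_eq (s t : R) :
  expi s = expi t -> exists k : int, t = s + k%:~R * (pi *+ 2).
Proof.
move=> /(congr1 val) /= [cst sst].
have /cos_eq1[k kE] : cos (t - s) = 1.
  by rewrite cosB cst sst -!expr2 cos2Dsin2.
by exists k; rewrite -kE addrC subrK.
Qed.

Lemma expiD2pin (k : int) (t : R) : expi (t + k%:~R * (pi *+ 2)) = expi t.
Proof. by apply/val_inj; rewrite /= cosD2pin sinD2pin. Qed.

Lemma expiDpi (t : R) : expi (t + pi) = circle_opp (expi t).
Proof. by apply/val_inj; rewrite /= cosDpi sinDpi. Qed.

Lemma expiN (t : R) : expi (- t) = circle_conj (expi t).
Proof. by apply/val_inj; rewrite /= cosN sinN. Qed.

Lemma int_pi_lt (k : int) : `|k%:~R * pi : R| < pi -> k = 0.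
Proof.
rewrite normrM (gtr0_norm (pi_gt0 R)) -[ltRHS]mul1r ltr_pM2r ?pi_gt0 //.
by rewrite -intr_norm (ltr_int R _ 1); lia.
Qed.

Lemma expi_surj (z : circle) : exists t, expi t = z.
Proof.
case: z => -[a b] /= ab.
have ab1 : a ^+ 2 + b ^+ 2 = 1.
  have := ab; rewrite normc_def => /eqP/(congr1 (@complex.Re R)) /= /eqP.
  by rewrite -[X in _ == X]sqrtr1 eqr_sqrt // ?addr_ge0 ?sqr_ge0 // => /eqP.
have a1 : -1 <= a <= 1.
  by apply/andP; split; nra.
have b2 : Num.sqrt (1 - a ^+ 2) = `|b|.
  by rewrite -ab1 addrC addKr sqrtr_sqr.
have [b0|b0] := leP 0 b.
  exists (acos a); apply/val_inj => /=.
  by rewrite acosK ?in_itv //= sin_acos // b2 ger0_norm.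
exists (- acos a); apply/val_inj => /=.
by rewrite cosN sinN acosK ?in_itv //= sin_acos // b2 ltr0_norm // opprK.
Qed.

Definition torus (n : nat) := {ffun 'I_n -> circle}.

End Torus.
Arguments circle : clear implicits.
Arguments torus : clear implicits.

Section RealBott.
Context {R : realType} {n : nat}.
Implicit Types (A : 'M[bool]_n) (z : torus R n) (e : 'rV['Z_2]_n).

Definition bott_gen A (i : 'I_n) z : torus R n :=
  [ffun j => if j == i then circle_opp (z j)
             else if (i < j)%N && A i j then circle_conj (z j)
             else z j].

(* The action of g_1 ^ e_1 ... g_n ^ e_n. *)
Definition bott_act A e z : torus R n :=
  foldr (fun i w => if e 0 i == 0 then w else bott_gen A i w) z (enum 'I_n).

Definition opp_if (b : bool) (z : circle R) := if b then circle_opp z else z.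
Definition conj_if (b : bool) (z : circle R) := if b then circle_conj z else z.

Definition conj_parity A e (j : 'I_n) : bool :=
  \big[addb/false]_(i < n | (i < j)%N && A i j) (e 0 i != 0).

Lemma circle_oppK : involutive (@circle_opp R).
Proof. by move=> z; apply/val_inj; rewrite /= opprK. Qed.

Lemma circle_conjK : involutive (@circle_conj R).
Proof. by move=> z; apply/val_inj; rewrite /= conjCK. Qed.

Lemma circle_conj_opp (z : circle R) :
  circle_conj (circle_opp z) = circle_opp (circle_conj z).
Proof. by apply/val_inj; rewrite /= rmorphN. Qed.

Lemma opp_ifD b c (z : circle R) : opp_if b (opp_if c z) = opp_if (b (+) c) z.
Proof. by case: b; case: c; rewrite //= circle_oppK. Qed.

Lemma conj_ifD b c (z : circle R) : conj_if b (conj_if c z) = conj_if (b (+) c) z.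
Proof. by case: b; case: c; rewrite //= circle_conjK. Qed.

Lemma conj_opp_if b c (z : circle R) : conj_if b (opp_if c z) = opp_if c (conj_if b z).
Proof. by case: b; case: c; rewrite //= circle_conj_opp. Qed.

Lemma bott_actE A e z j :
  bott_act A e z j = opp_if (e 0 j != 0) (conj_if (conj_parity A e j) (z j)).
Proof.
rewrite /bott_act (_ : conj_parity A e j = \big[addb/false]_(i <- enum 'I_n |
  (i < j)%N && A i j) (e 0 i != 0)); last by rewrite big_enum_cond.
have -> : (e 0 j != 0) = (j \in enum 'I_n) && (e 0 j != 0).
  by rewrite mem_enum.
have : uniq (enum 'I_n) by exact: enum_uniq.
elim: (enum 'I_n) => [|i s IH] /=; first by rewrite big_nil.
move=> /andP[is_ /IH{}IH]; rewrite big_cons inE.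
have [ei|ei] /= := eqVneq (e 0 i) 0.
  rewrite {}IH; have [->|_] /= := eqVneq j i; last by case: ifP.
  by rewrite ei eqxx !andbF; case: ifP.
rewrite ffunE {}IH; have [->|ji] /= := eqVneq j i.
  by rewrite ltnn /= (negbTE is_) ei.
case: ifP => _ //.
by rewrite -[circle_conj _]/(conj_if true _) conj_opp_if conj_ifD.
Qed.

Lemma bott_act0 A z : bott_act A 0 z = z.
Proof.
apply/ffunP => j; rewrite bott_actE !mxE eqxx /conj_parity big1 // => i _.
by rewrite mxE eqxx.
Qed.

Lemma Z2_neq0D (a b : 'Z_2) : (a + b != 0) = (a != 0) (+) (b != 0).
Proof. by case: a b => [[|[|//]] ?] [[|[|//]] ?]. Qed.

Lemma bott_actD A e e' z :
  bott_act A (e + e') z = bott_act A e (bott_act A e' z).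
Proof.
apply/ffunP => j; rewrite !bott_actE conj_opp_if conj_ifD opp_ifD mxE Z2_neq0D.
congr (opp_if _ (conj_if _ _)); rewrite /conj_parity -big_split /=.
by apply: eq_bigr => i _; rewrite mxE Z2_neq0D.
Qed.

Lemma bott_actK A e : involutive (bott_act A e).
Proof.
move=> z; rewrite -bott_actD (_ : e + e = 0) ?bott_act0 //.
by apply/rowP => i; rewrite !mxE; case: (e 0 i) => [[|[|//]] ?]; apply/val_inj.
Qed.

Definition bott_orbit A z w : bool := [exists e, bott_act A e z == w].

Lemma bott_orbitP A z w :
  reflect (exists e, bott_act A e z = w) (bott_orbit A z w).
Proof. by apply: (iffP existsP) => -[e /eqP ez]; exists e; rewrite ?ez. Qed.

Fact bott_orbit_equiv A : equiv_class_of (bott_orbit A).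
Proof.
split=> [z|z w|w z u].
- by apply/bott_orbitP; exists 0; rewrite bott_act0.
- by apply/bott_orbitP/bott_orbitP => -[e <-]; exists e; rewrite bott_actK.
- move=> /bott_orbitP[e <-] /bott_orbitP[e' <-]; apply/bott_orbitP.
  by exists (e' + e); rewrite bott_actD.
Qed.

Canonical bott_orbit_equivRel A := EquivRelPack (bott_orbit_equiv A).

Definition bott_quotient A := {eq_quot (bott_orbit A)}.

(* x |-> [exp(i x_1), ..., exp(i x_n)], which is a covering map from R^n. *)
Definition torus_exp (x : 'rV[R]_n) : torus R n := [ffun j => expi (x 0 j)].
Definition bott_cover A (x : 'rV[R]_n) : bott_quotient A :=
  \pi_(bott_quotient A) (torus_exp x).

(* The smooth structure for which the projections R^n -> T^n -> M(A) are local
   diffeomorphisms. *)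
Definition bott_atlas A : set (param n (bott_quotient A)) :=
  [set Param U (bott_cover A) |
    U in [set U | open U /\ set_inj U (bott_cover A)]].
Arguments bott_atlas A _ : clear implicits.

Lemma bott_coverP A x y :
  bott_cover A x = bott_cover A y <->
  exists e, bott_act A e (torus_exp x) = torus_exp y.
Proof.
split=> [/eqmodP/bott_orbitP //|xy].
by apply/eqmodP/bott_orbitP.
Qed.

Lemma bott_act_torus_exp A e x y : bott_act A e (torus_exp x) = torus_exp y ->
  exists s c : 'rV[R]_n, [/\ forall j, `|s 0 j| = 1, diag_affine s c x = y &
    forall x', torus_exp (diag_affine s c x') = bott_act A e (torus_exp x')].
Proof.
move=> exy.
pose s : 'rV[R]_n := \row_j (-1) ^+ conj_parity A e j.
pose c : 'rV[R]_n := \row_j (if e 0 j != 0 then pi else 0).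
have act x' : torus_exp (diag_affine s c x') = bott_act A e (torus_exp x').
  apply/ffunP => j; rewrite bott_actE !ffunE !mxE.
  case: (conj_parity A e j); case: (e 0 j != 0) => /=;
    by rewrite ?expr1 ?expr0 ?mulN1r ?mul1r ?addr0 ?expiDpi ?expiN.
have ex j : exists k : int, y 0 j = diag_affine s c x 0 j + k%:~R * (pi *+ 2).
  by apply: expi_eq; have /ffunP/(_ j) := exy; rewrite -act !ffunE.
have [k kE] := choice ex.
exists s, (c + \row_j ((k j)%:~R * (pi *+ 2))); split=> [j||x'].
- by rewrite mxE normrX normrN1 expr1n.
- by apply/rowP => j; rewrite kE !mxE addrA.
- by rewrite -act; apply/ffunP => j; rewrite !ffunE !mxE addrA expiD2pin.
Qed.

Lemma bott_act_first A e : e != 0 ->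
  exists2 i, e 0 i != 0 & conj_parity A e i = false.
Proof.
move=> /rV0Pn[i0 ei0].
have [i ei imin] := @arg_minnP _ i0 (fun i => e 0 i != 0) (fun i => i : nat) ei0.
exists i => //; rewrite /conj_parity big1 // => j /andP[ji _].
by apply: contraTF ji => /imin; rewrite -leqNgt.
Qed.

Lemma bott_act_free A e z : bott_act A e z = z -> e = 0.
Proof.
move=> /ffunP ez; apply/eqP; apply: contraT => /(bott_act_first A)[i ei ci].
have := ez i; rewrite bott_actE ei ci /= => /(congr1 val) /= /eqP.
by rewrite eqNr -normr_eq0 (eqP (valP (z i))) oner_eq0.
Qed.

Lemma bott_cover_inj_ball A (x : 'rV[R]_n) : set_inj (ball x 1) (bott_cover A).
Proof.
move=> y y' /set_mem[_ xy] /set_mem[_ xy'] /bott_coverP[e eyy'].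
have dist j : `|y' 0 j - y 0 j| < pi.
  have := pi_ge2 R; have := xy 0 j; have := xy' 0 j.
  rewrite /ball /= !ltr_norml => /andP[? ?] /andP[? ?] ?.
  by apply/andP; split; lra.
have e0 : e = 0.
  apply/eqP; apply: contraT => /(bott_act_first A)[i ei ci].
  have /ffunP/(_ i) := eyy'; rewrite bott_actE ei ci !ffunE /= -expiDpi.
  move=> /expi_eq[k kE]; have := dist i.
  rewrite kE (_ : _ - _ = (1 + k * 2)%:~R * pi); last by ring.
  by move=> /int_pi_lt; lia.
move: eyy'; rewrite e0 bott_act0 => /ffunP eyy'.
apply/rowP => j; have := eyy' j; rewrite !ffunE => /expi_eq[k kE].
have := dist j; rewrite kE (_ : _ - _ = (k * 2)%:~R * pi); last by ring.
move=> /int_pi_lt k0; rewrite (_ : k = 0) ?mul0r ?addr0 //; lia.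
Qed.

Lemma bott_atlas_open A phi : bott_atlas A phi -> open (pdom phi).
Proof. by move=> [U [Uo _] <-]. Qed.

Lemma bott_atlas_inj A phi : bott_atlas A phi -> set_inj (pdom phi) (pmap phi).
Proof. by move=> [U [_ Ui] <-]. Qed.

Lemma bott_atlas_cover A (p : bott_quotient A) :
  exists2 phi, bott_atlas A phi & (pmap phi @` pdom phi) p.
Proof.
have [x xE] := choice (fun j => expi_surj (repr p j)).
exists (Param (ball (\row_j x j) 1) (bott_cover A)).
  exists (ball (\row_j x j) 1) => //; split; last exact: bott_cover_inj_ball.
  exact: ball_open.
exists (\row_j x j) => /=; first exact: ballxx.
rewrite /bott_cover -[RHS]reprK; congr (\pi _).
by apply/ffunP => j; rewrite ffunE mxE xE.
Qed.

Lemma bott_atlas_compat A phi psi : bott_atlas A phi -> bott_atlas A psi ->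
  smooth_in phi psi id.
Proof.
move=> [U [Uo Ui] <-] [V [Vo Vi] <-]; rewrite /smooth_in /=; set W := _ `&` _.
have deck x : W x -> exists g : 'rV[R]_n -> 'rV[R]_n,
    [/\ forall k, Ck k setT g, V (g x) & forall x', bott_cover A (g x') = bott_cover A x'].
  move=> [_ [y Vy]] /= /esym /bott_coverP[e] /bott_act_torus_exp[s [c [s1 sE sact]]].
  exists (diag_affine s c); split; first by move=> k; exact: Ck_diag_affine.
    by rewrite sE.
  by move=> x'; apply/esym/bott_coverP; exists e.
have nearV (x : 'rV[R]_n) (g : 'rV[R]_n -> 'rV[R]_n) : Ck 0 setT g -> V (g x) -> nbhs x [set x' | V (g x')].
  move=> [gC _] Vgx; apply: (gC x I).
  exact: open_nbhs_nbhs.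
have nearW x : W x -> nbhs x W.
  move=> Wx; have [g [gC Vgx gE]] := deck x Wx.
  have Ux : nbhs x U by apply: open_nbhs_nbhs; split=> //; exact: Wx.1.
  have N : nbhs x (U `&` [set x' | V (g x')]).
    by apply: filterI => //; exact: nearV (gC 0%N) Vgx.
  apply: filterS N => x' [Ux' Vx'].
  by split=> //; exists (g x').
split; first by rewrite openE => x /nearW.
have ex x : exists y, W x -> V y /\ bott_cover A y = bott_cover A x.
  have [Wx|nWx] := pselect (W x); last by exists 0.
  by have [_ [y Vy yx]] := Wx; exists y.
have [h hP] := choice ex; exists h => // k.
apply: Ck_local => x Wx; have [g [gC Vgx gE]] := deck x Wx.
exists g; split=> //.
have N : nbhs x (W `&` [set x' | V (g x')]).
  by apply: filterI; [exact: nearW|exact: nearV (gC 0%N) Vgx].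
apply: filterS N => x' [Wx' Vx'].
have [Vhx' hx'] := hP x' Wx'.
by apply: Vi; rewrite ?inE // gE.
Qed.

Definition real_bott A : smoothManifold n :=
  SmoothManifold (@bott_atlas_open A) (@bott_atlas_inj A) (@bott_atlas_cover A)
    (@bott_atlas_compat A).

End RealBott.

(* Main.v *)
(* M(A) is the quotient of R^n by the group pi(A) = Z^n of maps
     deck A k : x |-> ((-1)^(s_j(k)) x_j + k_j pi)_j,
   where s_j(k) is the sum of the a_ij k_i for i < j.

   A diffeomorphism M(A) -> M(B) lifts to R^n -> R^n and so induces an
   isomorphism pi(A) -> pi(B).  The even vectors form a subgroup isomorphic to
   Z^n, generated by squares, and k^2 = 2 q_A(k) mod 4 with
   q_A(k)_j = k_j (1 + s_j(k)).  Hence the isomorphism yields linear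
   automorphisms psi and theta of F_2^n with q_B o psi = theta o q_A, and the
   numbers of (x, y, z) with q_A(x) = q_A(y) = q_A(z) and of (x, y) with
   q_A(x + y) = q_A(x) + q_A(y) are diffeomorphism invariants.

   Conversely, affine maps of R^n descend to diffeomorphisms realizing three
   moves on Bott matrices: relabelling; adding the q-th column to the j-th ones
   with a_qj = 1; and, if the columns l and m are equal, adding row m to row l.
   For n = 5 these moves leave 54 classes, which the two invariants separate. *)
Require Import Defs.
From mathcomp Require Import all_boot all_order all_algebra.
From mathcomp Require Import fingroup perm generic_quotient complex zify ring lra.
From mathcomp Require Import all_classical all_reals all_analysis.

Set Implicit Arguments.
Unset Strict Implicit.
Unset Printing Implicit Defensive.

Import Order.TTheory GRing.Theory Num.Theory numFieldNormedType.Exports.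

Local Open Scope classical_set_scope.
Local Open Scope ring_scope.
Local Open Scope quotient_scope.

(** * Deck transformations *)

Lemma int_parity (k : int) : exists (b : bool) (m : int), k = b%:Z + m * 2.
Proof.
exists (k %% 2 != 0)%Z, (k %/ 2)%Z; rewrite {1}(divz_eq k 2) addrC.
congr (_ + _); have := modz_ge0 k (isT : 2 != 0 :> int).
by have := ltz_pmod k (isT : 0 < 2 :> int); case: eqP => /=; lia.
Qed.

Lemma Z2_intr_bool (b : bool) (m : int) : (b%:Z + m * 2)%:~R = b%:R :> 'Z_2.
Proof.
rewrite rmorphD rmorphM /= (_ : 2%:~R = 0 :> 'Z_2) ?mulr0 ?addr0 //.
exact/val_inj.
Qed.

Lemma Z2_addxx (a : 'Z_2) : a + a = 0.
Proof. by case: a => [[|[|//]] ?]; apply/val_inj. Qed.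

Lemma Z2_intr_eq (k l : int) :
  k%:~R = l%:~R :> 'Z_2 -> exists m, k = l + m * 2.
Proof.
have [b [m ->]] := int_parity k; have [c [p ->]] := int_parity l.
rewrite !Z2_intr_bool => bc; exists (m - p); rewrite (_ : b = c); last first.
  by move: bc; case: b; case: c => // /(congr1 val).
by lia.
Qed.

Section Deck.
Context {R : realType} {n : nat}.
Implicit Types (A B : 'M[bool]_n) (k l : 'rV[int]_n) (x y : 'rV[R]_n).

Definition mod2 k : 'rV['Z_2]_n := map_mx intr k.

Definition deck A k x : 'rV[R]_n :=
  \row_j ((-1) ^+ conj_parity A (mod2 k) j * x 0 j + (k 0 j)%:~R * pi).

(** The group law of pi(A) on exponent vectors: [deckM] identifies it with composition. Its signs
    depend on [k] only modulo 2. *)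
Definition deck_mul A k l : 'rV[int]_n :=
  \row_j (k 0 j + (-1) ^+ conj_parity A (mod2 k) j * l 0 j).

Lemma conj_parityD A (e f : 'rV['Z_2]_n) j :
  conj_parity A (e + f) j = conj_parity A e j (+) conj_parity A f j.
Proof.
rewrite /conj_parity -big_split /=; apply: eq_bigr => i _.
by rewrite mxE Z2_neq0D.
Qed.

Lemma conj_parity0 A j : conj_parity A (0 : 'rV['Z_2]_n) j = false.
Proof. by rewrite /conj_parity big1 // => i _; rewrite mxE eqxx. Qed.

Lemma mod2D k l : mod2 (k + l) = mod2 k + mod2 l.
Proof. by apply/rowP => j; rewrite !mxE rmorphD. Qed.

Lemma mod2_double k : mod2 (k *+ 2) = 0.
Proof. by rewrite mulr2n mod2D; apply/rowP => j; rewrite !mxE Z2_addxx. Qed.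

Lemma mod2_eq k l : mod2 k = mod2 l -> exists m, k = l + m *+ 2.
Proof.
move=> /rowP kl.
have /choice[m mE] : forall j, exists m, k 0 j = l 0 j + m * 2.
  by move=> j; apply: Z2_intr_eq; have := kl j; rewrite !mxE.
exists (\row_j m j); apply/rowP => j.
by rewrite mulr2n !mxE mE; ring.
Qed.

Lemma mod2_mul A k l : mod2 (deck_mul A k l) = mod2 k + mod2 l.
Proof.
apply/rowP => j; rewrite !mxE rmorphD rmorphM /=.
case: (conj_parity A _ j); rewrite ?expr1 ?mul1r // mulN1r; congr (_ + _).
by apply/esym/eqP; rewrite -addr_eq0 Z2_addxx.
Qed.

Lemma expi_shift (k : int) (t : R) :
  expi (t + k%:~R * pi) = opp_if (k%:~R != 0 :> 'Z_2) (expi t).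
Proof.
have [b [m ->]] := int_parity k; rewrite Z2_intr_bool.
have -> : t + (b%:Z + m * 2)%:~R * pi = t + b%:R * pi + m%:~R * (pi *+ 2).
  by rewrite rmorphD rmorphM /= -pmulrn -mulr_natr; ring.
rewrite expiD2pin; case: b; first by rewrite mul1r expiDpi.
by rewrite mul0r addr0.
Qed.

Lemma torus_exp_deck A k x :
  torus_exp (deck A k x) = bott_act A (mod2 k) (torus_exp x).
Proof.
apply/ffunP => j; rewrite bott_actE !ffunE !mxE expi_shift; congr opp_if.
by case: conj_parity; rewrite ?expr1 ?expr0 ?mulN1r ?mul1r ?expiN.
Qed.

(** An element of the (Z_2)^n-action lifts to an integer vector [k0] with entries 0 and 1; what
    remains is a translation by multiples of 2 pi, absorbed by adding an even vector to [k0], which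
    leaves the signs unchanged. *)
Lemma bott_cover_deckP A x y :
  bott_cover A x = bott_cover A y <-> exists k, y = deck A k x.
Proof.
rewrite bott_coverP; split=> [[e ey]|[k ->]]; last first.
  by exists (mod2 k); rewrite torus_exp_deck.
pose k0 : 'rV[int]_n := \row_j (e 0 j)%:Z.
have k0e : mod2 k0 = e by apply/rowP => j; rewrite !mxE -pmulrn natr_Zp.
have /choice[m mE] j : exists m : int, y 0 j = deck A k0 x 0 j + m%:~R * (pi *+ 2).
  by apply: expi_eq; move: ey; rewrite -k0e -torus_exp_deck => /ffunP/(_ j); rewrite !ffunE.
exists (k0 + (\row_j m j + \row_j m j)); apply/rowP => j.
rewrite mE ![deck _ _ _ _ _]mxE -[X in k0 + X]mulr2n mod2D mod2_double addr0 mulr2n.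
rewrite !mxE !rmorphD /= -mulr_natr.
by move: (_ ^+ _ * _) (_%:~R) (_%:~R) (pi : R) => u v w p; ring.
Qed.

Lemma bott_cover_deck A k x : bott_cover A (deck A k x) = bott_cover A x.
Proof. by apply/esym/bott_cover_deckP; exists k. Qed.

Lemma bott_cover_surj A (p : bott_quotient A) : exists x : 'rV[R]_n, bott_cover A x = p.
Proof. by have [phi [U _ <-] [x _ xp]] := bott_atlas_cover p; exists x. Qed.

Lemma deckM A k l x : deck A (deck_mul A k l) x = deck A k (deck A l x).
Proof.
apply/rowP => j; rewrite !mxE mod2_mul conj_parityD rmorphD rmorphM rmorphXn /=.
rewrite signr_addb rmorphN1.
by move: (_ ^+ _) (_ ^+ _) (x 0 j) (_%:~R) (_%:~R) (pi : R) => s t u v w p; ring.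
Qed.

(** Freeness on the torus gives equal parities, hence equal signs; the translation parts can then be
    compared. *)
Lemma deck_inj A k l x : deck A k x = deck A l x -> k = l.
Proof.
move=> kl; have kl2 : mod2 k = mod2 l.
  have /(congr1 torus_exp) := kl; rewrite !torus_exp_deck => /(congr1 (bott_act A (mod2 l))).
  rewrite bott_actK -bott_actD => /bott_act_free lk.
  apply/eqP; rewrite -subr_eq0 -lk addrC; apply/eqP; congr (_ + _).
  apply/rowP => j; rewrite !mxE; apply/eqP; rewrite eq_sym -addr_eq0.
  by rewrite Z2_addxx.
apply/rowP => j; have /rowP/(_ j) := kl; rewrite !mxE kl2 => /addrI.
by move=> /(mulIf (lt0r_neq0 (pi_gt0 R)))/intr_inj.
Qed.

Lemma deck0 A x : deck A 0 x = x.
Proof.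
apply/rowP => j; rewrite !mxE (_ : mod2 0 = 0); last first.
  by apply/rowP => i; rewrite !mxE.
by rewrite conj_parity0 mul0r mul1r addr0.
Qed.

Definition deck_inv A k : 'rV[int]_n :=
  \row_j (- ((-1) ^+ conj_parity A (mod2 k) j * k 0 j)).

Lemma deck_mulV A k : deck_mul A k (deck_inv A k) = 0.
Proof.
by apply/rowP => j; rewrite !mxE mulrN mulrA -expr2 sqrr_sign mul1r subrr.
Qed.

Definition close (e : R) x y : Prop := forall j, `|x 0 j - y 0 j| < e.

Lemma close_sym e x y : close e x y -> close e y x.
Proof. by move=> xy j; rewrite distrC. Qed.

Lemma close_trans e1 e2 x y z : close e1 x y -> close e2 y z -> close (e1 + e2) x z.
Proof. by move=> xy yz j; rewrite (le_lt_trans (ler_distD (y 0 j) _ _)) ?ltrD. Qed.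

Lemma close_le e1 e2 x y : e1 <= e2 -> close e1 x y -> close e2 x y.
Proof. by move=> e12 xy j; exact: lt_le_trans (xy j) e12. Qed.

Lemma closexx e x : 0 < e -> close e x x.
Proof. by move=> e0 j; rewrite subrr normr0. Qed.

Lemma ball_close e x y : 0 < e -> ball x e y <-> close e x y.
Proof.
move=> e0; split=> [[_ xy] j|xy]; first exact: xy.
by split=> // i j; rewrite ord1; exact: xy.
Qed.

Lemma nbhs_close x (P : set 'rV[R]_n) :
  nbhs x P <-> exists2 e, 0 < e & forall y, close e x y -> P y.
Proof.
rewrite -nbhs_ballE; split=> -[e e0 eP]; exists e => // y.
  by move=> /(ball_close _ _ e0)/eP.
by move=> /(ball_close _ _ e0)/eP.
Qed.

Lemma deck_close A k e x y : close e (deck A k x) (deck A k y) <-> close e x y.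
Proof.
have E j : `|deck A k x 0 j - deck A k y 0 j| = `|x 0 j - y 0 j|.
  by rewrite !mxE opprD addrACA subrr addr0 -mulrBr normrM normr_sign mul1r.
by split=> xy j; move: (xy j); rewrite E.
Qed.

Lemma cover_close_inj A x y : bott_cover A x = bott_cover A y -> close 1 x y -> x = y.
Proof.
move=> xy /ball_close -/(_ ltr01) cxy; apply: (@bott_cover_inj_ball _ _ A x) => //.
  by rewrite inE; exact: ballxx.
by rewrite inE.
Qed.

End Deck.

(** * Lifting of uniformly liftable relations *)

Section Lifting.
Context {R : realType} {n m : nat} (L : 'rV[R]_n -> 'rV[R]_m -> Prop).

Definition separated : Prop := forall x y y', L x y -> L x y' -> close 1 y y' -> y = y'.

Definition unif_liftable : Prop := forall e : R, 0 < e -> exists2 d : R, 0 < d &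
  forall x y x', L x y -> close d x x' -> exists2 y', L x' y' & close e y y'.

Definition unif_lift (H : 'rV[R]_n -> 'rV[R]_m) : Prop :=
  (forall x, L x (H x)) /\
  (forall e : R, 0 < e -> exists2 d, 0 < d &
    forall x x', close d x x' -> close e (H x) (H x')).

Definition in_box (r : R) (x : 'rV[R]_n) : Prop := forall j, `|x 0 j| <= r.

(** The modulus 1/4 is chosen so that the sums of up to four such distances formed below stay under
    the separation constant 1. *)
Definition lift_on (d r : R) (H : 'rV[R]_n -> 'rV[R]_m) : Prop :=
  (forall x, in_box r x -> L x (H x)) /\
  (forall x x', in_box r x -> in_box r x' -> close d x x' -> close 4^-1 (H x) (H x')).

Lemma in_box_le (r s : R) x : r <= s -> in_box r x -> in_box s x.
Proof. by move=> rs xr j; exact: le_trans (xr j) rs. Qed.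

Lemma in_box0 (r : R) : 0 <= r -> in_box r 0.
Proof. by move=> r0 j; rewrite mxE normr0. Qed.

Lemma in_box_00 x : in_box 0 x -> x = 0.
Proof. by move=> x0; apply/rowP => j; have := x0 j; rewrite normr_le0 mxE => /eqP. Qed.

(** Successive boxes differ in radius by d/2, and scaling by N/(N+1) moves each coordinate by at
    most d/2 < d. This is the induction step from one box to the next. *)
Lemma box_shrink (d : R) N (x : 'rV[R]_n) : 0 < d -> in_box (N.+1%:R * (d / 2)) x ->
  in_box (N%:R * (d / 2)) ((N%:R / N.+1%:R) *: x) /\
  close d ((N%:R / N.+1%:R) *: x) x.
Proof.
move=> d0 xN; split=> j; have := xN j; rewrite !mxE => xj.
  rewrite normrM ger0_norm ?divr_ge0 // -mulrA ler_wpM2l //.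
  by rewrite ler_pdivrMl ?ltr0n.
have -> : N%:R / N.+1%:R * x 0 j - x 0 j = - (x 0 j / N.+1%:R) :> R.
  by rewrite -[N.+1%:R]natr1; field; rewrite natr1 pnatr_eq0.
rewrite normrN normrM normfV (ger0_norm (ler0n _ _)) ltr_pdivrMr ?ltr0n //.
rewrite (le_lt_trans xj) // mulrC ltr_pM2r ?ltr0n //.
by rewrite ltr_pdivrMr // ltr_pMr // ltr1n.
Qed.

Lemma shrink_close (d : R) N (x x' : 'rV[R]_n) : close d x x' ->
  close d ((N%:R / N.+1%:R) *: x) ((N%:R / N.+1%:R) *: x').
Proof.
move=> xx j; rewrite !mxE -mulrBr normrM ger0_norm ?divr_ge0 //.
apply: le_lt_trans (xx j); rewrite ler_piMl // ler_pdivrMr ?ltr0n //.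
by rewrite mul1r ler_nat.
Qed.

Lemma lift_on_le (d r s : R) H : s <= r -> lift_on d r H -> lift_on d s H.
Proof.
move=> sr [HL Hc]; split=> [x xs|x x' xs xs'].
  by apply: HL; exact: in_box_le xs.
by apply: Hc; [exact: in_box_le xs|exact: in_box_le xs'].
Qed.

(** Induction on the boxes: both values at [x] are within 1/4 of the common value at the shrunk
    point, so separation identifies them. *)
Lemma lift_on_uniq (d : R) N H H' : separated -> 0 < d ->
  lift_on d (N%:R * (d / 2)) H -> lift_on d (N%:R * (d / 2)) H' -> H 0 = H' 0 ->
  forall x, in_box (N%:R * (d / 2)) x -> H x = H' x.
Proof.
move=> Lsep d0 HH HH' H0; elim: N HH HH' => [|N IH] HH HH' x.
  by rewrite mul0r => /in_box_00 ->.
have d2 : 0 < d / 2 by rewrite divr_gt0.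
have le : N%:R * (d / 2) <= N.+1%:R * (d / 2) by rewrite ler_pM2r // ler_nat.
move=> xN; have [x'N x'x] := box_shrink d0 xN.
apply: (Lsep x); [exact: HH.1|exact: HH'.1|].
apply: (@close_le _ _ (4^-1 + 4^-1)); first by lra.
apply: close_trans (close_sym (HH.2 _ _ (in_box_le le x'N) xN x'x)) _.
rewrite (IH (lift_on_le le HH) (lift_on_le le HH')) //.
exact: HH'.2 (in_box_le le x'N) xN x'x.
Qed.

(* A lift on a box extends to the next larger one: [x] is lifted next to the
   lift of the point obtained by shrinking [x] into the smaller box. *)
Lemma lift_on_exists (d : R) N y0 : separated -> 0 < d ->
  (forall x y x', L x y -> close d x x' -> exists2 y', L x' y' & close 4^-1 y y') ->
  L 0 y0 -> exists2 H, lift_on d (N%:R * (d / 2)) H & H 0 = y0.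
Proof.
move=> Lsep d0 near Ly0; have q0 : 0 < 4^-1 :> R by rewrite invr_gt0.
elim: N => [|N [H HH H0]].
  exists (fun=> y0) => //; rewrite mul0r; split=> [x /in_box_00 -> //|x x' _ _ _].
  exact: closexx.
have ex x : exists y, in_box (N.+1%:R * (d / 2)) x ->
    L x y /\ close 4^-1 (H ((N%:R / N.+1%:R) *: x)) y.
  have [xN|xN] := pselect (in_box (N.+1%:R * (d / 2)) x); last by exists 0.
  have [x'N x'x] := box_shrink d0 xN.
  by have [y Ly cy] := near _ _ _ (HH.1 _ x'N) x'x; exists y.
have [H' H'P] := choice ex; exists H'.
  split=> [x /H'P[]//|x x' xN xN' xx'].
  have [Lx cx] := H'P _ xN; have [Lx' cx'] := H'P _ xN'.
  have [y' Ly' cy'] := near _ _ _ Lx xx'.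
  rewrite (Lsep _ _ _ Lx' Ly') //.
  apply: (@close_le _ _ (4^-1 + (4^-1 + 4^-1) + 4^-1)); first by lra.
  apply: close_trans cy'; apply: close_trans (close_sym cx') _.
  apply: close_trans cx; apply: close_sym.
  have [? _] := box_shrink d0 xN; have [? _] := box_shrink d0 xN'.
  by apply: HH.2 => //; exact: shrink_close.
have b0 : in_box (N.+1%:R * (d / 2)) (0 : 'rV[R]_n).
  by apply: in_box0; rewrite mulr_ge0 // divr_ge0 // ltW.
have [L0] := H'P _ b0; rewrite scaler0 H0 => c0.
apply/esym; apply: (Lsep 0) => //; apply: close_le c0; lra.
Qed.

Lemma box_cover (d : R) x : 0 < d -> exists N : nat, in_box (N%:R * (d / 2)) x.
Proof.
move=> d0; have d2 : 0 < d / 2 by rewrite divr_gt0.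
pose N (j : 'I_n) := (Num.truncn (`|x 0 j| / (d / 2))).+1.
exists (\max_j N j)%N => j.
rewrite -ler_pdivrMr //; apply: le_trans (ltW (truncnS_gt _)) _.
by rewrite ler_nat; apply: (@leq_bigmax _ N j).
Qed.

(** The lifts on the growing boxes agree where they overlap, by uniqueness. The global lift
    evaluates at [x] the lift on some box [b x] containing [x]. *)
Lemma unif_lift_exists y0 : separated -> unif_liftable -> L 0 y0 ->
  exists2 H, unif_lift H & H 0 = y0.
Proof.
move=> Lsep Lunif Ly0; have q0 : 0 < 4^-1 :> R by rewrite invr_gt0.
have [d d0 near] := Lunif _ q0.
have d2 : 0 < d / 2 by rewrite divr_gt0.
have ex N : exists H, lift_on d (N%:R * (d / 2)) H /\ H 0 = y0.
  by have [H ? ?] := lift_on_exists N Lsep d0 near Ly0; exists H.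
have [HN HNP] := choice ex.
have [b bP] := choice (fun x => box_cover x d0).
have indep N x : in_box (N%:R * (d / 2)) x -> HN (b x) x = HN N x.
  wlog le : N / (b x <= N)%N => [W xN|].
    have [le|/ltnW le] := leqP (b x) N; first exact: W.
    apply: (@lift_on_uniq d N) => //; first 1 last.
    - by have [] := HNP N.
    - by rewrite (HNP _).2 (HNP _).2.
    apply: lift_on_le (HNP (b x)).1.
    by rewrite ler_pM2r // ler_nat.
  move=> xN; apply: (@lift_on_uniq d (b x)) => //.
  - by have [] := HNP (b x).
  - by apply: lift_on_le (HNP N).1; rewrite ler_pM2r // ler_nat.
  - by rewrite (HNP _).2 (HNP _).2.
exists (fun x => HN (b x) x); last by rewrite (HNP _).2.
have HL x : L x (HN (b x) x) by apply: (HNP (b x)).1.1.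
(* Capping [e] at 1/4 keeps 1/4 + [e'] below 1, so that the value near [H x] supplied by liftability
   is the value of the lift at [x']. *)
split=> // e e0; pose e' := Num.min e 4^-1.
have e'0 : 0 < e' by rewrite lt_min e0 q0.
have [d' d'0 near'] := Lunif _ e'0; exists (Num.min d d'); first by rewrite lt_min d0.
move=> x x' xx'.
have xx1 : close d x x' by apply: close_le xx'; rewrite ge_min lexx.
have xx2 : close d' x x' by apply: close_le xx'; rewrite ge_min lexx orbT.
have [y' Ly' cy'] := near' _ _ _ (HL x) xx2.
rewrite (Lsep _ _ _ (HL x') Ly').
  by apply: close_le cy'; rewrite ge_min lexx.
pose N := maxn (b x) (b x').
have xN : in_box (N%:R * (d / 2)) x.
  by apply: in_box_le (bP x); rewrite ler_pM2r // ler_nat leq_maxl.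
have xN' : in_box (N%:R * (d / 2)) x'.
  by apply: in_box_le (bP x'); rewrite ler_pM2r // ler_nat leq_maxr.
rewrite (indep N x') //; move: cy'; rewrite (indep N x) // => cy'.
apply: (@close_le _ _ (4^-1 + e')).
  have e'4 : e' <= 4^-1 by rewrite ge_min lexx orbT.
  lra.
by apply: close_trans cy'; apply: close_sym; apply: (HNP N).1.2.
Qed.

Lemma unif_lift_uniq H H' : separated -> unif_lift H -> unif_lift H' ->
  H 0 = H' 0 -> forall x, H x = H' x.
Proof.
move=> Lsep [HL Hu] [HL' Hu'] H0 x; have q0 : 0 < 4^-1 :> R by rewrite invr_gt0.
have [d d0 dP] := Hu _ q0; have [d' d'0 dP'] := Hu' _ q0.
have e0 : 0 < Num.min d d' by rewrite lt_min d0.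
have [N xN] := box_cover x e0.
apply: (lift_on_uniq Lsep e0 _ _ H0 xN); split=> // y y' _ _ yy.
  by apply: dP; apply: close_le yy; rewrite ge_min lexx.
by apply: dP'; apply: close_le yy; rewrite ge_min lexx orbT.
Qed.

End Lifting.

(** * Lifts of smooth maps *)

Section BottLift.
Context {R : realType} {n : nat}.
Implicit Types (A B : 'M[bool]_n).

Definition lies_over A B (f : @bott_quotient R n A -> @bott_quotient R n B)
  (x y : 'rV[R]_n) : Prop := bott_cover B y = f (bott_cover A x).

Lemma lies_over_sep A B (f : bott_quotient A -> bott_quotient B) :
  separated (lies_over f).
Proof. by move=> x y y' Lxy Lxy'; apply: (@cover_close_inj _ _ B); rewrite Lxy Lxy'. Qed.

(** In the unit-ball charts around [x] and around a point [y0] over its image, the local expression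
    [h] of [f] is a continuous local lift. *)
Lemma smooth_lies_over_local A B
    (f : @real_bott R n A -> @real_bott R n B) (x : 'rV[R]_n) (e : R) :
  smooth_map f -> 0 < e ->
  exists y, \forall x' \near x, exists2 y', lies_over f x' y' & close e y y'.
Proof.
move=> fs e0; have [y0 y0E] := bott_cover_surj (f (bott_cover A x)).
have chart (C : 'M[bool]_n) (z : 'rV[R]_n) : @bott_atlas R n C (Param (ball z 1) (bott_cover C)).
  by exists (ball z 1) => //; split; [exact: ball_open|exact: bott_cover_inj_ball].
have [/= Wo [h hs hP]] := fs _ _ (chart A x) (chart B y0).
set W := (X in open X) in Wo hs hP.
have Wx : W x by split; [exact: ballxx|exists y0 => //; exact: ballxx].
exists (h x); have [hc _] := hs 0%N.
have N : nbhs x (W `&` [set x' | close e (h x) (h x')]).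
  apply: filterI; first exact: open_nbhs_nbhs.
  by apply: (hc x Wx); apply/nbhs_close; exists e.
apply: filterS N => x' [Wx' cx']; exists (h x') => //.
by have [] := hP x' Wx'.
Qed.

Lemma lies_over_deckr A B (f : bott_quotient A -> bott_quotient B) k x y :
  lies_over f x y -> lies_over f x (deck B k y).
Proof. by rewrite /lies_over bott_cover_deck. Qed.

Lemma lies_over_deckl A B (f : bott_quotient A -> bott_quotient B) k x y :
  lies_over f (deck A k x) y <-> lies_over f x y.
Proof. by rewrite /lies_over bott_cover_deck. Qed.

(** Even vectors act as pure translations by multiples of 2 pi, which suffice to reduce every
    coordinate. *)
Lemma deck_box A (x : 'rV[R]_n) : exists k (v : 'rV[R]_n),
  x = deck A k v /\ forall j, v 0 j \in `[0, pi *+ 2].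
Proof.
have p0 : 0 < pi *+ 2 :> R by rewrite mulrn_wgt0 // pi_gt0.
pose m j := Num.floor (x 0 j / (pi *+ 2)).
exists (\row_j m j + \row_j m j), (\row_j (x 0 j - (m j)%:~R * (pi *+ 2))); split.
  apply/rowP => j; rewrite mxE -[X in mod2 X]mulr2n mod2_double conj_parity0.
  by rewrite !mxE rmorphD /= -mulr_natr; ring.
move=> j; rewrite mxE in_itv /=; apply/andP; split.
  by rewrite subr_ge0 -ler_pdivlMr // floor_le.
rewrite lerBlDl -[X in _ + X]mul1r -mulrDl -ler_pdivrMr //.
by rewrite ltW // -intrD1 floorD1_gt.
Qed.

Lemma smooth_unif_liftable A B (f : @real_bott R n A -> @real_bott R n B) :
  smooth_map f -> unif_liftable (lies_over f).
Proof.
move=> fs e e0; have e2 : 0 < e / 2 by rewrite divr_gt0.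
pose P (d : R) (x : 'rV[R]_n) := forall x' y, lies_over f x y -> close d x x' ->
  exists2 y', lies_over f x' y' & close e y y'.
pose K : set 'rV[R]_n := [set v | forall j, `[0, pi *+ 2]%classic (v 0 j)].
have Kc : compact K.
  apply: (@rV_compact _ _ (fun=> `[0, pi *+ 2]%classic)) => j.
  exact: segment_compact.
(* It suffices to find a uniform [d] on the compact box [K], which contains a
   fundamental domain of the deck group, acting by isometries. *)
have loc (x : 'rV[R]_n) : K x -> \forall x' \near x & d \near 0^'+, P d x'.
  move=> _; have [y0 /nbhs_close[r r0 rP]] := smooth_lies_over_local x fs e2.
  have r2 : 0 < r / 2 by rewrite divr_gt0.
  exists ([set x' | close (r / 2) x x'], [set d | d < r / 2]).
    by split; [apply/nbhs_close; exists (r / 2)|exact: nbhs_right_lt].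
  move=> [x1 d] [/= xx1 dr] x2 y Ly x12.
  have [y1 Ly1 cy1] : exists2 y', lies_over f x1 y' & close (e / 2) y0 y'.
    by apply: rP; apply: close_le xx1; lra.
  have [y3 Ly3 cy3] : exists2 y', lies_over f x2 y' & close (e / 2) y0 y'.
    by apply: rP; apply: (@close_le _ _ (r / 2 + d)); [lra|exact: close_trans x12].
  (* The local statement only provides points near [y0]; the isometry carrying [y1] to the
     prescribed [y] carries [y3] to the required nearby point. *)
  have /bott_cover_deckP[k ->] : bott_cover B y1 = bott_cover B y by rewrite Ly Ly1.
  exists (deck B k y3); first exact: lies_over_deckr.
  apply/deck_close; rewrite [e]splitr; apply: close_trans cy3.
  exact: close_sym.
have Pnear : \forall d \near 0^'+, K `<=` P d.
  exact: (compact_near_coveringP K).1 Kc _ _ _ _ loc.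
near (0 : R)^'+ => d.
have KP : K `<=` P d by near: d.
exists d => // x y x' Lxy xx'.
have [k [v [xE vK]]] := deck_box A x.
have x'E : x' = deck A k (deck A (deck_inv A k) x') by rewrite -deckM deck_mulV deck0.
move: Lxy xx'; rewrite xE x'E => /lies_over_deckl Lvy /deck_close vv'.
have [y' Ly' cy'] := KP v vK _ _ Lvy vv'.
by exists y' => //; apply/lies_over_deckl.
Unshelve. all: by end_near. Qed.

Lemma smooth_lift A B (f : @real_bott R n A -> @real_bott R n B) :
  smooth_map f -> exists H, unif_lift (lies_over f) H.
Proof.
move=> fs; have [y0 Ly0] := bott_cover_surj (f (bott_cover A 0)).
have [H HL _] := unif_lift_exists (@lies_over_sep _ _ f) (smooth_unif_liftable fs) Ly0.
by exists H.
Qed.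

Lemma unif_lift_deckr A B (f : bott_quotient A -> bott_quotient B) k H :
  unif_lift (lies_over f) H -> unif_lift (lies_over f) (deck B k \o H).
Proof.
move=> [HL Hu]; split=> [x|e /Hu[d d0 dP]]; first exact: lies_over_deckr.
by exists d => // x x' /dP ?; apply/deck_close.
Qed.

Lemma unif_lift_deckl A B (f : bott_quotient A -> bott_quotient B) k H :
  unif_lift (lies_over f) H -> unif_lift (lies_over f) (H \o deck A k).
Proof.
move=> [HL Hu]; split=> [x|e /Hu[d d0 dP]]; first by apply/(lies_over_deckl _ k).
by exists d => // x x' ?; apply: dP; apply/deck_close.
Qed.

(** A deck transformation matches the two lifts at 0, and uniqueness of lifts does the rest. *)
Lemma unif_lift_eq_deck A B (f : bott_quotient A -> bott_quotient B) H H' :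
  unif_lift (lies_over f) H -> unif_lift (lies_over f) H' ->
  exists k, forall x, H' x = deck B k (H x).
Proof.
move=> HL HL'; have /bott_cover_deckP[k k0] : bott_cover B (H 0) = bott_cover B (H' 0).
  by rewrite HL.1 HL'.1.
exists k; apply: (unif_lift_uniq (@lies_over_sep _ _ f) HL') => //.
exact: unif_lift_deckr.
Qed.

Lemma unif_lift_comp A B C (f : bott_quotient A -> bott_quotient B)
    (g : bott_quotient B -> bott_quotient C) H G :
  unif_lift (lies_over f) H -> unif_lift (lies_over g) G ->
  unif_lift (lies_over (g \o f)) (G \o H).
Proof.
move=> [HL Hu] [GL Gu]; split=> [x|e /Gu[d /Hu[d' d'0 dP'] dP]].
  by rewrite /lies_over /= GL HL.
by exists d' => // x x' /dP'/dP.
Qed.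

Lemma unif_lift_id A : unif_lift (lies_over (@id (@bott_quotient R n A))) id.
Proof. by split=> // e e0; exists e. Qed.

Definition deck_hom A B (phi : 'rV[int]_n -> 'rV[int]_n) : Prop :=
  forall k l, phi (deck_mul A k l) = deck_mul B (phi k) (phi l).

(** Precomposing [H] with a deck transformation gives another lift of [f], hence [H] followed by a
    deck transformation; freeness makes the correspondence multiplicative. *)
Lemma unif_lift_hom A B (f : bott_quotient A -> bott_quotient B) H :
  unif_lift (lies_over f) H -> exists2 phi, deck_hom A B phi &
    forall k x, H (deck A k x) = deck B (phi k) (H x).
Proof.
move=> HL; have ex k : exists l, forall x, H (deck A k x) = deck B l (H x).
  exact: unif_lift_eq_deck HL (unif_lift_deckl k HL).
have [phi phiP] := choice ex; exists phi => // k l.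
by apply: (@deck_inj R _ B _ _ (H 0)); rewrite deckM -!phiP deckM.
Qed.

(** [G \o H] lifts the identity, so it is a deck transformation [a]. As the two lifts are chosen
    independently, [psi \o phi] is conjugation by [a] rather than the identity. *)
Lemma cancel_deck_hom A B (f : bott_quotient A -> bott_quotient B)
    (g : bott_quotient B -> bott_quotient A) H G phi psi :
  cancel f g -> unif_lift (lies_over f) H -> unif_lift (lies_over g) G ->
  (forall k x, H (deck A k x) = deck B (phi k) (H x)) ->
  (forall k x, G (deck B k x) = deck A (psi k) (G x)) ->
  exists a, forall k, deck_mul A a k = deck_mul A (psi (phi k)) a.
Proof.
move=> fg HL GL phiP psiP; have GH := unif_lift_comp HL GL.
have fgE : g \o f = id by apply/funext => p; exact: fg.
rewrite fgE in GH; have [a aP] := unif_lift_eq_deck (@unif_lift_id A) GH.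
exists a => k; apply: (@deck_inj R _ A _ _ 0).
by rewrite !deckM -[deck A k 0]/(id (deck A k 0)) -!aP /= phiP psiP.
Qed.

Lemma diffeo_deck_hom A B : diffeomorphic (@real_bott R n A) (@real_bott R n B) ->
  exists phi psi a, [/\ deck_hom A B phi, deck_hom B A psi &
    forall k, deck_mul A a k = deck_mul A (psi (phi k)) a].
Proof.
move=> [f [g [fg gf fs gs]]]; have [H HL] := smooth_lift fs.
have [G GL] := smooth_lift gs.
have [phi phiM phiP] := unif_lift_hom HL; have [psi psiM psiP] := unif_lift_hom GL.
have [a aP] := cancel_deck_hom fg HL GL phiP psiP.
by exists phi, psi, a.
Qed.

End BottLift.

(** * The quadratic map of a Bott matrix *)

Section SquareForm.
Context {n : nat}.
Implicit Types (A B : 'M[bool]_n) (k l w : 'rV[int]_n) (x y : 'rV['Z_2]_n).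

(** The map q_A: the square of [k] in pi(A) is twice [half_sq A k], whose reduction modulo 2 is
    [sqf A (mod2 k)]. *)
Definition sqf A x : 'rV['Z_2]_n :=
  \row_j (if conj_parity A x j then 0 else x 0 j).

Definition half_sq A k : 'rV[int]_n :=
  \row_j (if conj_parity A (mod2 k) j then 0 else k 0 j).

Lemma deck_mulkk A k : deck_mul A k k = half_sq A k *+ 2.
Proof.
apply/rowP => j; rewrite mulr2n !mxE.
by case: conj_parity; rewrite ?mulN1r ?subrr ?addr0 ?mul1r.
Qed.

Lemma mod2_half_sq A k : mod2 (half_sq A k) = sqf A (mod2 k).
Proof. by apply/rowP => j; rewrite !mxE; case: ifP. Qed.

Lemma deck_mulEl A w k : deck_mul A (w *+ 2) k = w *+ 2 + k.
Proof.
by apply/rowP => j; rewrite mxE mod2_double conj_parity0 mul1r [in RHS]mxE.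
Qed.

Definition lift2 (x : 'rV['Z_2]_n) : 'rV[int]_n := \row_j (x 0 j)%:Z.

Lemma lift2K x : mod2 (lift2 x) = x.
Proof. by apply/rowP => j; rewrite !mxE -pmulrn natr_Zp. Qed.

Section Hom.
Variables (A B : 'M[bool]_n) (phi : 'rV[int]_n -> 'rV[int]_n).
Hypothesis phiM : deck_hom A B phi.

Lemma deck_hom0 : phi 0 = 0.
Proof.
have E C : deck_mul C 0 0 = 0 :> 'rV[int]_n.
  by apply/rowP => j; rewrite !mxE mulr0 addr0.
have := phiM 0 0; rewrite E => /rowP h; apply/rowP => j.
have := h j; rewrite !mxE -[X in X = _ -> _]addr0 => /addrI.
by case: conj_parity; rewrite ?mulN1r ?mul1r // => /esym/eqP; rewrite oppr_eq0 => /eqP.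
Qed.

Lemma mod2_deck_homD w w' :
  mod2 (phi ((w + w') *+ 2)) = mod2 (phi (w *+ 2)) + mod2 (phi (w' *+ 2)).
Proof. by rewrite mulrnDl -(deck_mulEl A) phiM mod2_mul. Qed.

Lemma mod2_deck_hom_double w : mod2 (phi (w *+ 2)) = 0.
Proof.
(* [w *+ 2] is the product of the squares of the [w 0 i *: delta_mx 0 i]. *)
have z : mod2 (0 : 'rV[int]_n) = 0 by apply/rowP => j; rewrite !mxE.
rewrite (row_sum_delta w).
rewrite (big_morph (fun w => mod2 (phi (w *+ 2))) mod2_deck_homD (_ : _ = 0)); last first.
  by rewrite mul0rn deck_hom0.
apply: big1 => i _.
have -> : (w 0 i *: delta_mx 0 i) *+ 2 = deck_mul A (w 0 i *: delta_mx 0 i) (w 0 i *: delta_mx 0 i).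
  rewrite deck_mulkk; congr (_ *+ 2); apply/rowP => j; rewrite !mxE eqxx.
  case: ifP => //; have [->|] /= := eqVneq j i; last by rewrite mulr0.
  rewrite /conj_parity big1 // => i' /andP[lt _]; rewrite !mxE eqxx /=.
  by rewrite (_ : i' == i = false) ?mulr0 ?eqxx //; apply: contraTF lt => /eqP ->; rewrite ltnn.
rewrite phiM mod2_mul; apply/rowP => j; rewrite !mxE; exact: Z2_addxx.
Qed.

(** [phi] preserves the even vectors; halving its restriction to them gives [t], the integral form
    of theta. *)
Lemma deck_hom_halves : exists t : 'rV[int]_n -> 'rV[int]_n,
  forall w, phi (w *+ 2) = t w *+ 2.
Proof.
suff /choice[t tP] : forall w, exists u, phi (w *+ 2) = u *+ 2 by exists t.
move=> w; have [|u uE] := @mod2_eq _ (phi (w *+ 2)) 0.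
  by rewrite mod2_deck_hom_double; apply/rowP => j; rewrite !mxE.
by exists u; rewrite uE add0r.
Qed.

Lemma mod2_deck_hom k l : mod2 k = mod2 l -> mod2 (phi k) = mod2 (phi l).
Proof.
move=> /mod2_eq[m ->]; rewrite addrC -(deck_mulEl A) phiM mod2_mul.
by rewrite mod2_deck_hom_double add0r.
Qed.

Variable t : 'rV[int]_n -> 'rV[int]_n.
Hypothesis tP : forall w, phi (w *+ 2) = t w *+ 2.

Lemma double_inj : injective (fun w : 'rV[int]_n => w *+ 2).
Proof.
move=> w w' /rowP h; apply/rowP => j; have := h j; rewrite !mulr2n !mxE.
by move: (w _ _) (w' _ _) => u v; lia.
Qed.

Lemma halvesD w w' : t (w + w') = t w + t w'.
Proof.
apply: double_inj; rewrite mulrnDl -!tP mulrnDl -(deck_mulEl A) phiM.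
by rewrite tP deck_mulEl -tP.
Qed.

Lemma mod2_halves w w' : mod2 w = mod2 w' -> mod2 (t w) = mod2 (t w').
Proof.
move=> /mod2_eq[m ->]; rewrite halvesD mulr2n halvesD -mulr2n mod2D mod2_double.
by rewrite addr0.
Qed.

(** The integral form of q_B o psi = theta o q_A: a homomorphism maps squares to squares. *)
Lemma halves_half_sq k : t (half_sq A k) = half_sq B (phi k).
Proof. by apply: double_inj; rewrite -tP -!deck_mulkk phiM. Qed.

End Hom.

(** Additive maps of F_2^n are linear and injective ones are bijective, so [psi] and [theta] are
    linear automorphisms. *)
Definition sqf_equiv A B : Prop :=
  exists psi theta : 'rV['Z_2]_n -> 'rV['Z_2]_n,
  [/\ injective psi /\ injective theta, {morph psi : x y / x + y},
      {morph theta : x y / x + y} & forall x, sqf B (psi x) = theta (sqf A x)].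

(** Conjugation by [a] is trivial modulo 2, and on even vectors it only changes signs of
    coordinates, so it is also trivial on their halves modulo 2. Hence the maps induced by [phi']
    are left inverses of those induced by [phi]. *)
Lemma deck_hom_sqf_equiv A B phi phi' a :
  deck_hom A B phi -> deck_hom B A phi' ->
  (forall k, deck_mul A a k = deck_mul A (phi' (phi k)) a) -> sqf_equiv A B.
Proof.
move=> phiM phiM' aP; have [t tP] := deck_hom_halves phiM.
have [t' tP'] := deck_hom_halves phiM'.
exists (fun x => mod2 (phi (lift2 x))), (fun x => mod2 (t (lift2 x))); split.
- split.
    apply: (@can_inj _ _ _ (fun x => mod2 (phi' (lift2 x)))) => x.
    rewrite (mod2_deck_hom phiM' (lift2K _)) -[RHS]lift2K.
    have /(congr1 (@mod2 n)) := aP (lift2 x); rewrite !mod2_mul addrC.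
    by move=> /addIr.
  apply: (@can_inj _ _ _ (fun x => mod2 (t' (lift2 x)))) => x.
  rewrite (mod2_halves phiM' tP' (lift2K _)) -[RHS]lift2K.
  (* At an even vector the conjugation identity reads coordinatewise t'(t(x)) = x or -x. *)
  have := aP (lift2 x *+ 2); rewrite tP tP' deck_mulEl => /rowP h.
  apply/rowP => j; have := h j; rewrite !mulr2n !mxE [LHS]addrC => /addIr.
  move: (t' _ _ _) => u; case: conj_parity; rewrite ?mulN1r ?mul1r => E.
    have {}E : u = - (x 0 j)%:Z by lia.
    by rewrite E rmorphN; apply/eqP; rewrite eq_sym -addr_eq0 Z2_addxx.
  by have -> : u = (x 0 j)%:Z by lia.
- move=> x y; rewrite -(mod2_mul B) -phiM; apply: (mod2_deck_hom phiM).
  by rewrite mod2_mul !lift2K.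
- move=> x y; rewrite -mod2D -(halvesD phiM tP); apply: (mod2_halves phiM tP).
  by rewrite mod2D !lift2K.
- move=> x; rewrite -mod2_half_sq -(halves_half_sq phiM tP).
  by apply: (mod2_halves phiM tP); rewrite mod2_half_sq !lift2K.
Qed.

(** This is the sum of the cubes of the fibre sizes of q_A. *)
Definition sqf_collisions A : nat :=
  #|[set p : 'rV['Z_2]_n * 'rV['Z_2]_n * 'rV['Z_2]_n |
     (sqf A p.1.1 == sqf A p.1.2) && (sqf A p.1.1 == sqf A p.2)]%SET|.

(** These are the zeros of the polarization q_A(x + y) - q_A(x) - q_A(y). *)
Definition sqf_additive_pairs A : nat :=
  #|[set p : 'rV['Z_2]_n * 'rV['Z_2]_n |
     sqf A (p.1 + p.2) == sqf A p.1 + sqf A p.2]%SET|.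

Lemma sqf_equiv_collisions A B : sqf_equiv A B -> sqf_collisions A = sqf_collisions B.
Proof.
move=> [psi [theta [[psi_inj theta_inj] psiD thetaD sqE]]].
pose F p := (psi p.1.1, psi p.1.2, psi p.2).
have F_inj : injective F by move=> [[? ?] ?] [[? ?] ?] [/psi_inj -> /psi_inj -> /psi_inj ->].
rewrite /sqf_collisions -[RHS](on_card_preimset (f := F)).
  by apply: eq_card => -[[x y] z]; rewrite !inE /= !sqE !(inj_eq theta_inj).
exact: onW_bij (injF_bij F_inj).
Qed.

Lemma sqf_equiv_additive_pairs A B :
  sqf_equiv A B -> sqf_additive_pairs A = sqf_additive_pairs B.
Proof.
move=> [psi [theta [[psi_inj theta_inj] psiD thetaD sqE]]].
pose F p := (psi p.1, psi p.2).
have F_inj : injective F by move=> [? ?] [? ?] [/psi_inj -> /psi_inj ->].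
rewrite /sqf_additive_pairs -[RHS](on_card_preimset (f := F)).
  apply: eq_card => -[x y]; rewrite !inE /= -psiD !sqE -thetaD.
  by rewrite !(inj_eq theta_inj).
exact: onW_bij (injF_bij F_inj).
Qed.

End SquareForm.

Lemma diffeo_sqf_invariants (R : realType) n (A B : 'M[bool]_n) :
  diffeomorphic (@real_bott R n A) (@real_bott R n B) ->
  sqf_collisions A = sqf_collisions B /\ sqf_additive_pairs A = sqf_additive_pairs B.
Proof.
move=> /diffeo_deck_hom[phi [psi [a [phiM psiM aP]]]].
have E := deck_hom_sqf_equiv phiM psiM aP.
by rewrite (sqf_equiv_collisions E) (sqf_equiv_additive_pairs E).
Qed.

(** * Affine diffeomorphisms *)

Section Affine.
Context {R : realType} {n : nat}.
Implicit Types (A B C : 'M[bool]_n) (F G : 'rV[R]_n -> 'rV[R]_n).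

Definition affine_map F : Prop :=
  exists (P : 'M[R]_n) (c : 'rV[R]_n), forall x, F x = x *m P + c.

Lemma affine_comp F G : affine_map F -> affine_map G -> affine_map (G \o F).
Proof.
move=> [P [c FE]] [Q [d GE]]; exists (P *m Q), (c *m Q + d) => x.
by rewrite /= GE FE mulmxDl mulmxA addrA.
Qed.

Lemma affine_id : affine_map id.
Proof. by exists 1%:M, 0 => x; rewrite mulmx1 addr0. Qed.

Lemma affine_deck A k : affine_map (deck A k).
Proof.
exists (diag_mx (\row_j (-1) ^+ conj_parity A (mod2 k) j)), (\row_j ((k 0 j)%:~R * pi)) => x.
by apply/rowP => j; rewrite mul_mx_diag !mxE mulrC.
Qed.

Lemma affine_continuous F : affine_map F -> continuous F.
Proof.
move=> [P [c FE]] x B /nbhs_close[e e0 eB]; apply/nbhs_close.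
(* [M] strictly dominates every column sum of absolute values of [P]; the summand 1 gives strictness
   and positivity. *)
pose M := 1 + \sum_i \sum_j `|P i j|.
have M0 : 0 < M by rewrite ltr_pwDl // sumr_ge0 // => i _; exact: sumr_ge0.
exists (e / M) => [|y xy]; first exact: divr_gt0.
apply: eB => j; rewrite !FE !mxE opprD addrACA subrr addr0 -sumrB.
apply: le_lt_trans (ler_norm_sum _ _ _) _.
apply: (@le_lt_trans _ _ (\sum_i e / M * `|P i j|)).
  apply: ler_sum => i _; rewrite -mulrBl normrM ler_wpM2r // ltW //; exact: xy.
rewrite -mulr_sumr -mulrA gtr_pMr // mulrC ltr_pdivrMr // mul1r.
rewrite -[ltLHS]add0r ltr_leD //; apply: ler_sum => i _.
by rewrite (bigD1 j) //= lerDl sumr_ge0.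
Qed.

(** The difference quotients in direction [v] are constantly [v *m P], so the first derivatives are
    constant maps. *)
Lemma Ck_affine k F : affine_map F -> Ck k setT F.
Proof.
move=> Fa; case: k => [|k]; split; try by move=> x _; exact: affine_continuous.
  by [].
have [P [c FE]] := Fa.
have dE v x : is_derive x v F (v *m P).
  have H : (fun h => h^-1 *: ((F \o shift x) (h *: v) - F x)) @ 0^' --> v *m P.
    apply: cvg_near_cst; near=> h.
    have h0 : h != 0 by near: h; exact: nbhs_dnbhs_neq.
    by rewrite /= !FE opprD addrACA subrr addr0 -mulmxBl addrK -scalemxAl scalerA mulVf // scale1r.
  apply: DeriveDef; first by apply/cvg_ex; exists (v *m P).
  exact: cvg_lim H.
move=> i; split=> [x _|]; first exact: ex_derive.
rewrite (_ : 'D_(delta_mx 0 i) _ = fun=> delta_mx 0 i *m P).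
  exact: Ck_cst.
by apply/funext => x; apply: derive_val.
Unshelve. all: by end_near. Qed.

(** Near each point the expression of [f] in charts is [F] followed by a single deck transformation,
    which is affine. *)
Lemma affine_smooth_map A B F (f : @real_bott R n A -> @real_bott R n B) :
  affine_map F -> (forall x, f (bott_cover A x) = bott_cover B (F x)) -> smooth_map f.
Proof.
move=> Fa fE _ _ [U [Uo Ui] <-] [V [Vo Vi] <-]; rewrite /smooth_in /=; set W := _ `&` _.
have local x : W x -> exists g, [/\ affine_map g, V (g x) &
    forall x', bott_cover B (g x') = f (bott_cover A x')].
  move=> [_ [y Vy]] /= /esym; rewrite fE => /bott_cover_deckP[k yE].
  exists (deck B k \o F); split; first exact: affine_comp (affine_deck B k).
    by rewrite /= -yE.
  by move=> x'; rewrite /= bott_cover_deck fE.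
have nearV x g : affine_map g -> V (g x) -> nbhs x [set x' | V (g x')].
  by move=> /affine_continuous gc Vgx; apply: (gc x); exact: open_nbhs_nbhs.
have nearW x : W x -> nbhs x W.
  move=> Wx; have [g [ga Vgx gE]] := local x Wx.
  have N : nbhs x (U `&` [set x' | V (g x')]).
    by apply: filterI; [apply: open_nbhs_nbhs; split=> //; exact: Wx.1|exact: nearV].
  by apply: filterS N => x' [Ux' Vx']; split=> //; exists (g x').
split; first by rewrite openE => x /nearW.
(* The local expression [h] is chosen pointwise, with value 0 off [W]; injectivity of the cover on
   [V] forces it to agree with the affine [g] near [x]. *)
have ex x : exists y, W x -> V y /\ bott_cover B y = f (bott_cover A x).
  have [Wx|nWx] := pselect (W x); last by exists 0.
  by have [_ [y Vy yx]] := Wx; exists y.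
have [h hP] := choice ex; exists h => // k.
apply: Ck_local => x Wx; have [g [ga Vgx gE]] := local x Wx.
exists g; split; last exact: Ck_affine.
have N : nbhs x (W `&` [set x' | V (g x')]).
  by apply: filterI; [exact: nearW|exact: nearV].
apply: filterS N => x' [Wx' Vx']; have [Vhx' hx'] := hP x' Wx'.
by apply: Vi; rewrite ?inE // gE.
Qed.

Definition covers A B F : Prop :=
  forall x y, bott_cover A x = bott_cover A y -> bott_cover B (F x) = bott_cover B (F y).

Definition affine_equiv A B : Prop := exists F G,
  [/\ affine_map F /\ covers A B F, affine_map G /\ covers B A G,
      cancel F G & cancel G F].

Lemma affine_equiv_refl A : affine_equiv A A.
Proof. by exists id, id; split=> //; split=> //; exact: affine_id. Qed.

Lemma affine_equiv_sym A B : affine_equiv A B -> affine_equiv B A.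
Proof. by move=> [F [G [? ? ? ?]]]; exists G, F. Qed.

Lemma affine_equiv_trans A B C :
  affine_equiv A B -> affine_equiv B C -> affine_equiv A C.
Proof.
move=> [F [G [[Fa Fc] [Ga Gc] FK GK]]] [F' [G' [[Fa' Fc'] [Ga' Gc'] FK' GK']]].
exists (F' \o F), (G \o G'); split; [| |exact: can_comp|exact: can_comp].
  by split; [exact: affine_comp|move=> x y /Fc/Fc'].
by split; [exact: affine_comp|move=> x y /Gc'/Gc].
Qed.

(** The induced maps are defined through set-theoretic sections of the covers; [covers] makes them
    independent of that choice. *)
Lemma affine_equiv_diffeo A B :
  affine_equiv A B -> diffeomorphic (@real_bott R n A) (@real_bott R n B).
Proof.
move=> [F [G [[Fa Fc] [Ga Gc] FK GK]]].
have [sA sAP] := choice (@bott_cover_surj R n A).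
have [sB sBP] := choice (@bott_cover_surj R n B).
pose f p : bott_quotient B := bott_cover B (F (sA p)).
pose g p : bott_quotient A := bott_cover A (G (sB p)).
have fE x : f (bott_cover A x) = bott_cover B (F x) by apply: Fc; rewrite sAP.
have gE x : g (bott_cover B x) = bott_cover A (G x) by apply: Gc; rewrite sBP.
exists f, g; split.
- by move=> p; rewrite -(sAP p) fE gE FK.
- by move=> p; rewrite -(sBP p) gE fE GK.
- exact: affine_smooth_map fE.
- exact: affine_smooth_map gE.
Qed.

Lemma covers_deck A B F (k' : 'rV[int]_n -> 'rV[int]_n) :
  (forall k x, F (deck A k x) = deck B (k' k) (F x)) -> covers A B F.
Proof. by move=> Fk x y /bott_cover_deckP[k ->]; rewrite Fk bott_cover_deck. Qed.

End Affine.

(** * Moves on Bott matrices *)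

Section Moves.
Context {R : realType} {n : nat}.
Implicit Types (A B : 'M[bool]_n) (e : 'rV['Z_2]_n) (k : 'rV[int]_n).

(** The adjacency relation of an acyclic digraph, through which alone [A] enters the deck group. *)
Definition arrow A (i j : 'I_n) : bool := (i < j)%N && A i j.

Lemma arrow_irr A i : arrow A i i = false.
Proof. by rewrite /arrow ltnn. Qed.

Lemma conj_parityE A e j :
  conj_parity A e j = \big[addb/false]_i (arrow A i j && (e 0 i != 0)).
Proof. by rewrite /conj_parity big_mkcond; apply: eq_bigr => i _; rewrite -/(arrow A i j); case: arrow. Qed.

Lemma conj_parity_delta A q j (b : bool) :
  conj_parity A (\row_i (b && (i == q))%:R) j = b && arrow A q j.
Proof.
rewrite conj_parityE (bigD1 q) //= big1 => [|i /negbTE iq]; rewrite !mxE ?iq ?eqxx ?andbT ?andbF ?eqxx ?andbF //.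
by rewrite addbF; case: b; rewrite ?eqxx ?oner_eq0 ?andbT ?andbF.
Qed.

Lemma Z2_intr_sign (b : bool) (m : int) : ((-1) ^+ b * m)%:~R = m%:~R :> 'Z_2.
Proof.
case: b; rewrite ?mul1r // mulN1r rmorphN.
by apply/esym/eqP; rewrite -addr_eq0 Z2_addxx.
Qed.

Lemma Z2_natr_neq0 (a : 'Z_2) : a = (a != 0)%:R.
Proof. by case: a => [[|[|//]] ?]; apply/val_inj. Qed.

(** Permuting the coordinates of R^n conjugates one deck group into the other. *)
Lemma affine_equiv_perm A B (s : 'S_n) :
  (forall i j, arrow B i j = arrow A (s i) (s j)) -> affine_equiv (R := R) A B.
Proof.
have half C D (u : 'S_n) : (forall i j, arrow D i j = arrow C (u i) (u j)) ->
    affine_map (col_perm u : 'rV[R]_n -> _) /\ covers C D (col_perm u : 'rV[R]_n -> _).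
  move=> CD; split; first by exists (perm_mx (u^-1)%g), 0 => x; rewrite col_permE addr0.
  apply: (covers_deck (k' := col_perm u)) => k x; apply/rowP => j; rewrite !mxE.
  suff -> : conj_parity D (mod2 (col_perm u k)) j = conj_parity C (mod2 k) (u j) by [].
  rewrite !conj_parityE [RHS](reindex_inj (@perm_inj _ u)).
  by apply: eq_bigr => i _; rewrite CD !mxE.
move=> AB; exists (col_perm s), (col_perm (s^-1)%g); split.
- exact: half.
- by apply: half => i j; rewrite AB !permKV.
- by move=> x; rewrite -col_permM mulVg col_perm1.
- by move=> x; rewrite -col_permM mulgV col_perm1.
Qed.

(** Realized by translating x_q by pi/2. Conjugation by it changes k_q by 1 exactly when [deck A k]
    reflects x_q, and the change of columns compensates for the altered parity of k_q. *)
Lemma affine_equiv_shift A B q :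
  (forall i j, arrow B i j = arrow A i j (+) (arrow A q j && arrow A i q)) ->
  affine_equiv (R := R) A B.
Proof.
pose t (b : bool) : 'rV[R]_n := ((-1) ^+ b * (pi / 2)) *: delta_mx 0 q.
have half (C D : 'M[bool]_n) (b : bool) :
    (forall i j, arrow D i j = arrow C i j (+) (arrow C q j && arrow C i q)) ->
    affine_map (fun x => x + t b) /\ covers C D (fun x => x + t b).
  move=> CD; split; first by exists 1%:M, (t b) => x; rewrite mulmx1.
  pose sh k := \row_i (conj_parity C (mod2 k) q && (i == q))%:R : 'rV[int]_n.
  apply: (covers_deck (k' := fun k => k + (-1) ^+ b *: sh k)) => k x.
  (* The signs of the new deck transformation are those of [deck C k]: the contribution of [sh k]
     and that of the new columns are the same and cancel. *)
  have -> : deck D (k + (-1) ^+ b *: sh k) (x + t b) = \row_j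
      ((-1) ^+ conj_parity C (mod2 k) j * (x + t b) 0 j +
      ((k + (-1) ^+ b *: sh k) 0 j)%:~R * pi).
    apply/rowP => j; rewrite mxE [RHS]mxE mod2D.
    have -> : mod2 ((-1) ^+ b *: sh k) = \row_i (conj_parity C (mod2 k) q && (i == q))%:R.
      by apply/rowP => i; rewrite mxE [X in X%:~R]mxE Z2_intr_sign !mxE rmorph_nat.
    rewrite conj_parityD conj_parity_delta CD arrow_irr andbF addbF.
    have -> : conj_parity D (mod2 k) j =
        conj_parity C (mod2 k) j (+) (arrow C q j && conj_parity C (mod2 k) q).
      rewrite !conj_parityE [in RHS]big_distrr -big_split; apply: eq_bigr => i _ /=.
      by rewrite CD andb_addl andbA.
    by rewrite [_ && arrow _ _ _]andbC addbK.
  apply/rowP => j; rewrite !mxE eqxx /=; have [->|jq] := eqVneq j q; last first.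
    by rewrite !andbF !mulr0 !addr0.
  rewrite !andbT rmorphD rmorphM rmorphXn rmorphN1 rmorph_nat /=.
  by case: (conj_parity C _ q) => /=; field.
have tN b x : x + t b + t (~~ b) = x.
  rewrite /t signrN mulNr scaleNr addrK //.
move=> AB; exists (fun x => x + t false), (fun x => x + t true); split.
- exact: half.
(* The move fixes row and column q, so applied to [B] it restores [A]. *)
- apply: half => i j; rewrite !AB !arrow_irr !andbF /= !addbF.
  by rewrite -addbA addbb addbF.
- by move=> x; exact: (tN false).
- by move=> x; exact: (tN true).
Qed.

(** Realized by the shear adding x_l to x_m. Equal columns give x_l and x_m the same sign under each
    deck transformation, so the shear commutes with the signs. It adds k_l to k_m, which the new row
    l compensates. *)
Lemma affine_equiv_slide A B l m : l != m ->
  (forall i, arrow A i l = arrow A i m) ->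
  (forall i j, arrow B i j = arrow A i j (+) ((i == l) && arrow A m j)) ->
  affine_equiv (R := R) A B.
Proof.
move=> lm Alm AB.
pose sl (b : bool) (x : 'rV[R]_n) : 'rV[R]_n := x + ((-1) ^+ b * x 0 l) *: delta_mx 0 m.
have half (C D : 'M[bool]_n) (b : bool) : (forall i, arrow C i l = arrow C i m) ->
    (forall i j, arrow D i j = arrow C i j (+) ((i == l) && arrow C m j)) ->
    affine_map (sl b) /\ covers C D (sl b).
  move=> Clm CD; split.
    exists (1%:M + (-1) ^+ b *: delta_mx l m), 0 => x.
    rewrite addr0 mulmxDr mulmx1 -scalemxAr; congr (_ + _).
    apply/rowP => j; rewrite -scalerA !mxE (bigD1 l) //= big1 => [|i /negbTE il].
      by rewrite !mxE eqxx addr0.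
    by rewrite mxE il mulr0.
  pose k' k : 'rV[int]_n := k + ((-1) ^+ b * k 0 l) *: delta_mx 0 m.
  apply: (covers_deck (k' := k')) => k x.
  have -> : deck D (k' k) (sl b x) = \row_j
      ((-1) ^+ conj_parity C (mod2 k) j * sl b x 0 j + (k' k 0 j)%:~R * pi).
    apply/rowP => j; rewrite mxE [RHS]mxE mod2D.
    have -> : mod2 (((-1) ^+ b * k 0 l) *: delta_mx 0 m) =
        \row_i ((mod2 k 0 l != 0) && (i == m))%:R.
      apply/rowP => i; rewrite !mxE eqxx -mulrA Z2_intr_sign rmorphM rmorph_nat /=.
      by rewrite [X in X * _]Z2_natr_neq0 -natrM mulnb.
    rewrite conj_parityD conj_parity_delta CD [m == l]eq_sym (negbTE lm) addbF.
    have -> : conj_parity D (mod2 k) j =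
        conj_parity C (mod2 k) j (+) ((mod2 k 0 l != 0) && arrow C m j).
      rewrite !conj_parityE (eq_bigr (fun i => (arrow C i j && (mod2 k 0 i != 0)) (+)
        ((i == l) && (arrow C m j && (mod2 k 0 i != 0))))) => [|i _]; last first.
        by rewrite CD andb_addl andbA.
      rewrite big_split; congr (_ (+) _).
      by rewrite (bigD1 l) //= eqxx big1 => [|i /negbTE -> //]; rewrite addbF /= andbC.
    by rewrite addbK.
  have pm : conj_parity C (mod2 k) m = conj_parity C (mod2 k) l.
    by rewrite !conj_parityE; apply: eq_bigr => i _; rewrite Clm.
  apply/rowP => j; rewrite !mxE eqxx /=; have [->|jm] := eqVneq j m; last first.
    by rewrite !mulr0 !addr0.
  rewrite pm !mulr1 rmorphD rmorphM rmorphXn rmorphN1 /=.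
  by move: (_ ^+ b) (_ ^+ conj_parity _ _ _) (pi : R) (_%:~R) (_%:~R) => s t p u v; ring.
(* Hence the move leaves columns l and m unchanged, still equal, and applying it again to [B]
   restores [A]. *)
have Aml : arrow A m l = false by rewrite Alm arrow_irr.
have slN b x : sl (~~ b) (sl b x) = x.
  rewrite /sl [in X in _ + X]mxE !mxE eqxx (negbTE lm) mulr0 addr0.
  by rewrite signrN mulNr scaleNr addrK.
exists (sl false), (sl true); split.
- exact: half.
- apply: half => [i|i j]; rewrite !AB ?Aml ?arrow_irr ?andbF ?addbF //.
  by rewrite [m == l]eq_sym (negbTE lm) /= addbF -addbA addbb addbF.
- by move=> x; exact: (slN false).
- by move=> x; exact: (slN true).
Qed.

End Moves.

(** * Enumeration of the Bott matrices of size 5 *)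

Section Codes.
Variable n : nat.
Implicit Types (c : seq (seq bool)) (s : seq bool).

(* A Bott matrix is encoded by the list of its rows, of which only the entries
   above the diagonal are significant. *)
Definition entry c (i j : nat) : bool := (i < j)%N && nth false (nth [::] c i) j.

Definition code_mx c : 'M[bool]_n := \matrix_(i, j) ((i == j) || entry c i j).

Definition tabulate (f : nat -> nat -> bool) : seq (seq bool) :=
  [seq [seq f i j | j <- iota 0 n] | i <- iota 0 n].

Lemma arrow_code c (i j : 'I_n) : arrow (code_mx c) i j = entry c i j.
Proof. by rewrite /arrow mxE /entry; case: ltngtP => // ij; rewrite -val_eqE ltn_eqF. Qed.

Lemma entry_tabulate f (i j : 'I_n) : entry (tabulate f) i j = (i < j)%N && f i j.
Proof.
by rewrite /entry /tabulate (nth_map 0%N) ?size_iota // (nth_map 0%N) ?size_iota // !nth_iota.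
Qed.

(** A move yields at most one code: none if its side condition [b] fails or if the result is not
    strictly upper triangular. *)
Definition guard (b : bool) (f : nat -> nat -> bool) : seq (seq (seq bool)) :=
  if b && all (fun i => all (fun j => (i < j)%N || ~~ f i j) (iota 0 n)) (iota 0 n)
  then [:: tabulate f] else [::].

Lemma guardP b f c : c \in guard b f ->
  b /\ forall i j : 'I_n, arrow (code_mx c) i j = f i j.
Proof.
rewrite /guard; case: ifP => // /andP[-> /allP fP]; rewrite inE => /eqP ->; split=> // i j.
have /allP := fP i ltac:(by rewrite mem_iota /=).
move=> /(_ j); rewrite mem_iota /= ltn_ord => /(_ isT).
by rewrite arrow_code entry_tabulate; case: ltnP => //= _ /negbTE.
Qed.

Definition swap_nat (p i : nat) : nat :=
  if i == p then p.+1 else if i == p.+1 then p else i.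

(** Relabelling and row addition are restricted to neighbouring indices; the ranges [n.-1] keep the
    successor index in bounds. *)
Definition moves c : seq (seq (seq bool)) :=
  flatten ([seq guard true (fun i j => entry c (swap_nat p i) (swap_nat p j)) |
              p <- iota 0 n.-1] ++
           [seq guard true (fun i j => entry c i j (+) (entry c q j && entry c i q)) |
              q <- iota 0 n] ++
           [seq guard (all (fun i => entry c i l == entry c i l.+1) (iota 0 n))
                      (fun i j => entry c i j (+) ((i == l) && entry c l.+1 j)) |
              l <- iota 0 n.-1]).

Lemma moves_equiv (R : realType) c d :
  d \in moves c -> affine_equiv (R := R) (code_mx c) (code_mx d).
Proof.
have n1 p : p \in iota 0 n.-1 -> (p < n)%N /\ (p.+1 < n)%N.
  by rewrite mem_iota /=; case: n => //= n'; rewrite ltnS => pn; rewrite ltnW.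
move=> /flattenP[ds]; rewrite !mem_cat => /or3P[] /mapP[p pn ->] /guardP[hb dE].
- have [p0 p1] := n1 _ pn.
  apply: (affine_equiv_perm (s := tperm (Ordinal p0) (Ordinal p1))) => i j.
  have sw (k : 'I_n) : swap_nat p k = tperm (Ordinal p0) (Ordinal p1) k.
    by rewrite permE /= /swap_nat -!val_eqE /=; case: ifP => // _; case: ifP.
  by rewrite dE !sw arrow_code.
- have {}pn : (p < n)%N by move: pn; rewrite mem_iota.
  by apply: (affine_equiv_shift (q := Ordinal pn)) => i j; rewrite dE !arrow_code.
- have [p0 p1] := n1 _ pn.
  apply: (affine_equiv_slide (l := Ordinal p0) (m := Ordinal p1)).
  + by rewrite -val_eqE /= ltn_eqF.
  + move=> i; rewrite !arrow_code; apply/eqP; move/allP: hb; apply.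
    by rewrite mem_iota /=.
  + by move=> i j; rewrite dE !arrow_code -val_eqE.
Qed.

(** Depth-first exploration by [moves], expanding at most [fuel] codes. Everything returned is
    equivalent to the starting code whatever the fuel; too little fuel can only miss codes. *)
Fixpoint search (fuel : nat) (visited todo : seq (seq (seq bool))) :=
  if fuel isn't fuel'.+1 then visited else
  if todo isn't c :: todo' then visited else
  let new := undup [seq d <- moves c | d \notin visited] in
  search fuel' (new ++ visited) (new ++ todo').

Lemma search_equiv (R : realType) fuel visited todo c :
  {subset todo <= visited} ->
  (forall d, d \in visited -> affine_equiv (R := R) (code_mx c) (code_mx d)) ->
  forall d, d \in search fuel visited todo -> affine_equiv (R := R) (code_mx c) (code_mx d).
Proof.
elim: fuel visited todo => [|fuel IH] visited [|b todo] //= sub eqv; apply: IH.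
  move=> d; rewrite !mem_cat => /orP[->//|dt]; apply/orP; right.
  by apply: sub; rewrite inE dt orbT.
move=> d; rewrite mem_cat mem_undup mem_filter => /orP[/andP[_ /moves_equiv bd]|]; last exact: eqv.
by apply: affine_equiv_trans (eqv b _) (bd R); apply: sub; rewrite inE eqxx.
Qed.

(** * Computing the two invariants on bit sequences *)

Fixpoint bitseqs (k : nat) : seq bitseq :=
  if k is k'.+1 then [seq b :: s | b <- [:: false; true], s <- bitseqs k'] else [:: [::]].

Lemma mem_bitseqs k s : (s \in bitseqs k) = (size s == k).
Proof.
elim: k s => [|k IH] [|b s] //.
  by apply/negbTE/negP => /allpairsP[[? ?] []].
rewrite eqSS -IH; apply/allpairsP/idP => [[[b' s'] /= [_ ? [_ ->]]]//|ss].
by exists (b, s); split=> //; case: b.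
Qed.

Lemma bitseqs_uniq k : uniq (bitseqs k).
Proof.
elim: k => // k IH; apply: allpairs_uniq => // -[b s] [b' s'] _ _ /= [-> ->] //.
Qed.

Definition bits_row s : 'rV['Z_2]_n := \row_j (nth false s j)%:R.

Lemma Z2_bool_neq0 (b : bool) : (b%:R != 0 :> 'Z_2) = b.
Proof. by case: b. Qed.

Lemma sum_bitseqs (F : 'rV['Z_2]_n -> nat) :
  (\sum_x F x = \sum_(s <- bitseqs n) F (bits_row s))%N.
Proof.
rewrite -(big_map bits_row xpredT F); apply: perm_big; apply: uniq_perm.
- exact: index_enum_uniq.
- rewrite map_inj_in_uniq ?bitseqs_uniq // => s t; rewrite !mem_bitseqs.
  move=> /eqP sn /eqP tn /rowP st; apply: (@eq_from_nth _ false); first by rewrite sn.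
  move=> i; rewrite sn => i_n; have := st (Ordinal i_n); rewrite !mxE /=.
  by case: nth; case: nth.
move=> x; rewrite mem_index_enum; apply/esym/mapP.
exists [seq x 0 j != 0 | j <- enum 'I_n]; first by rewrite mem_bitseqs size_map size_enum_ord.
apply/rowP => j; rewrite mxE (nth_map j) ?size_enum_ord // nth_ord_enum.
exact: Z2_natr_neq0.
Qed.

Definition bits_add s t : seq bool := [seq p.1 (+) p.2 | p <- zip s t].

Lemma bits_rowD s t : size s = n -> size t = n ->
  bits_row (bits_add s t) = bits_row s + bits_row t.
Proof.
move=> sn tn; apply/rowP => j; rewrite !mxE (nth_map (false, false)); last first.
  by rewrite size_zip sn tn minnn.
rewrite nth_zip ?sn ?tn //=.
by case: nth; case: nth => /=; apply/val_inj.
Qed.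

Definition bits_sqf c s : seq bool :=
  [seq nth false s j && ~~ foldr addb false [seq entry c i j && nth false s i | i <- iota 0 n]
     | j <- iota 0 n].

Lemma size_bits_sqf c s : size (bits_sqf c s) = n.
Proof. by rewrite size_map size_iota. Qed.

Lemma bits_sqfE c s : sqf (code_mx c) (bits_row s) = bits_row (bits_sqf c s).
Proof.
apply/rowP => j; rewrite !mxE (nth_map 0%N) ?size_iota // nth_iota // add0n.
have -> : conj_parity (code_mx c) (bits_row s) j =
    foldr addb false [seq entry c i j && nth false s i | i <- iota 0 n].
  rewrite conj_parityE foldrE big_map -[X in iota 0 X]subn0 big_mkord.
  by apply: eq_bigr => i _; rewrite arrow_code mxE Z2_bool_neq0.
by case: foldr; rewrite ?andbF ?andbT.
Qed.

Lemma bits_row_inj s t : size s = n -> size t = n -> bits_row s = bits_row t -> s = t.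
Proof.
move=> sn tn /rowP st; apply: (@eq_from_nth _ false); first by rewrite sn.
move=> i; rewrite sn => i_n; have := st (Ordinal i_n); rewrite !mxE /=.
by case: nth; case: nth.
Qed.

(** The list [t] keeps repetitions: a value taken m times contributes m terms m^2, that is, the cube
    m^3. *)
Definition bits_collisions c : nat :=
  let t := [seq bits_sqf c s | s <- bitseqs n] in
  sumn [seq ((count_mem y t) ^ 2)%N | y <- t].

Definition bits_additive_pairs c : nat :=
  sumn [seq count (fun s' => bits_sqf c (bits_add s s') ==
                      bits_add (bits_sqf c s) (bits_sqf c s')) (bitseqs n)
         | s <- bitseqs n].

Lemma bits_additive_pairsE c : sqf_additive_pairs (code_mx c) = bits_additive_pairs c.
Proof.
rewrite /sqf_additive_pairs cardsE -sum1_card big_mkcond -(pair_bigA _ (fun x y =>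
  if sqf (code_mx c) (x + y) == sqf (code_mx c) x + sqf (code_mx c) y then 1%N else 0%N)) /=.
rewrite sum_bitseqs /bits_additive_pairs sumnE big_map; apply: eq_big_seq => s.
rewrite mem_bitseqs => /eqP sn.
rewrite sum_bitseqs -sum1_count [RHS]big_mkcond; apply: eq_big_seq => t.
rewrite mem_bitseqs => /eqP tn.
rewrite -bits_rowD // !bits_sqfE -bits_rowD ?size_bits_sqf //.
congr (if _ then _ else _); apply/eqP/eqP => [/bits_row_inj|-> //].
by apply; rewrite ?size_map ?size_iota // size_zip !size_map !size_iota minnn.
Qed.

Lemma bits_collisionsE c : sqf_collisions (code_mx c) = bits_collisions c.
Proof.
set q := sqf (code_mx c).
have fib s : size s = n ->
    #|[set y | q (bits_row s) == q y]%SET| = count_mem (bits_sqf c s) [seq bits_sqf c s | s <- bitseqs n].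
  move=> sn; rewrite -sum1dep_card big_mkcond sum_bitseqs count_map -sum1_count.
  rewrite [RHS]big_mkcond; apply: eq_big_seq => t; rewrite mem_bitseqs => /eqP tn.
  rewrite /= /q !bits_sqfE eq_sym; congr (if _ then _ else _).
  apply/eqP/eqP => [/bits_row_inj|-> //]; by apply; rewrite size_bits_sqf.
(* For a fixed first entry, the other two range independently over its fibre. *)
have -> : sqf_collisions (code_mx c) = (\sum_x #|[set y | q x == q y]%SET| ^ 2)%N.
  rewrite /sqf_collisions -sum1dep_card big_mkcond -(pair_bigA _ (fun p z =>
    if (q p.1 == q p.2) && (q p.1 == q z) then 1%N else 0%N)) /=.
  rewrite -(pair_bigA _ (fun x y =>
    \sum_z if (q x == q y) && (q x == q z) then 1%N else 0%N)%N) /=.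
  apply: eq_bigr => x _; rewrite expnS expn1 -sum1dep_card big_distrl big_mkcond /=.
  rewrite [RHS]big_mkcond; apply: eq_bigr => y _; rewrite mul1n.
  by case: ifP => _ /=; [rewrite -big_mkcond|rewrite big1].
rewrite sum_bitseqs /bits_collisions sumnE !big_map; apply: eq_big_seq => s.
by rewrite mem_bitseqs => /eqP sn; rewrite fib.
Qed.

End Codes.

(** * Listing all Bott matrices and extracting representatives *)

Definition upper_pairs (n : nat) : seq (nat * nat) :=
  [seq p <- [seq (i, j) | i <- iota 0 n, j <- iota 0 n] | (p.1 < p.2)%N].

Definition bits_code (n : nat) (s : bitseq) : seq (seq bool) :=
  tabulate n (fun i j => (i < j)%N && nth false s (index (i, j) (upper_pairs n))).

Definition bott_codes (n : nat) : seq (seq (seq bool)) :=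
  [seq bits_code n s | s <- bitseqs (size (upper_pairs n))].

Lemma bott_codesP (n : nat) (A : 'M[bool]_n) :
  bott_matrix A -> exists2 c, c \in bott_codes n & A = code_mx n c.
Proof.
move=> /andP[/forallP Adiag /forallP Alow].
(* [a] extends the entries of [A] to pairs of natural numbers, with default [false] out of range. *)
pose a (p : nat * nat) := if insub p.1 is Some i then if insub p.2 is Some j then A i j else false else false.
pose s := map a (upper_pairs n).
exists (bits_code n s); first by apply: map_f; rewrite mem_bitseqs size_map.
apply/matrixP => i j; rewrite mxE; have [->|ij] := eqVneq i j; first by rewrite Adiag.
rewrite entry_tabulate; case: ltngtP => /= [lt|gt|/val_inj eq]; last by rewrite eq eqxx in ij.
  rewrite (nth_map (0, 0)%N); last first.
    by rewrite index_mem mem_filter lt; apply/allpairsP; exists (nat_of_ord i, nat_of_ord j); rewrite !mem_iota /= !ltn_ord.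
  rewrite nth_index; last first.
    by rewrite mem_filter lt; apply/allpairsP; exists (nat_of_ord i, nat_of_ord j); rewrite !mem_iota /= !ltn_ord.
  by rewrite /a /= !valK.
by have /forallP/(_ j)/implyP/(_ gt)/negbTE := Alow i.
Qed.

Lemma code_mx_bott (n : nat) c : bott_matrix (code_mx n c).
Proof.
apply/andP; split; apply/forallP => i; first by rewrite mxE eqxx.
apply/forallP => j; apply/implyP => ji; rewrite mxE /entry ltnNge (ltnW ji) orbF.
by apply: contraTN ji => /eqP ->; rewrite ltnn.
Qed.

Lemma search_visited n fuel visited todo : {subset visited <= search n fuel visited todo}.
Proof.
elim: fuel visited todo => [|fuel IH] visited [|c todo] //= d dv.
by apply: IH; rewrite mem_cat dv orbT.
Qed.

(* The second component of [acc] collects the classes already visited. *)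
Definition add_rep (n fuel : nat) (acc : seq (seq (seq bool)) * seq (seq (seq bool))) c :=
  if c \in acc.2 then acc else (rcons acc.1 c, search n fuel [:: c] [:: c] ++ acc.2).

Definition reps (n fuel : nat) : seq (seq (seq bool)) :=
  (foldl (add_rep n fuel) ([::], [::]) (bott_codes n)).1.

Lemma reps_cover (R : realType) n fuel c : c \in bott_codes n ->
  exists2 r, r \in reps n fuel & affine_equiv (R := R) (code_mx n r) (code_mx n c).
Proof.
(* Along the fold, every visited code stays equivalent to a recorded representative, and every code
   processed ends up visited. *)
pose inv (acc : seq (seq (seq bool)) * seq (seq (seq bool))) := forall d, d \in acc.2 ->
  exists2 r, r \in acc.1 & affine_equiv (R := R) (code_mx n r) (code_mx n d).
suff H s acc : inv acc -> inv (foldl (add_rep n fuel) acc s) /\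
    forall d, (d \in s) || (d \in acc.2) -> d \in (foldl (add_rep n fuel) acc s).2.
  have [//|invr sub] := H (bott_codes n) ([::], [::]).
  by move=> cb; apply: invr; apply: sub; rewrite cb.
elim: s acc => [|b s IH] acc acc_inv /=; first by split.
have [|inv' sub'] := IH (add_rep n fuel acc b).
  rewrite /add_rep; case: ifP => // _ d; rewrite mem_cat => /orP[db|/acc_inv[r rr rd]].
    exists b; first by rewrite mem_rcons mem_head.
    apply: search_equiv db => // e; rewrite inE => /eqP ->; exact: affine_equiv_refl.
  by exists r => //; rewrite mem_rcons inE rr orbT.
split=> // d; rewrite inE -orbA => dP; apply: sub'.
case/or3P: dP => [/eqP ->|->//|da]; rewrite /add_rep.
  case: ifP => [->|_]; first by rewrite orbT.
  by rewrite mem_cat search_visited ?mem_head ?orbT.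
by case: ifP => _; rewrite ?mem_cat da !orbT.
Qed.

(** A computation over the 2^10 codes. It also certifies the fuel 100: a class split by an
    incomplete search would give two representatives with equal invariants. *)
Lemma reps5_invariants : (size (reps 5 100) == 54%N) &&
  uniq [seq (bits_collisions 5 r, bits_additive_pairs 5 r) | r <- reps 5 100].
Proof. by vm_compute. Qed.

Lemma reps5_exist (R : realType) : exists rs : seq (seq (seq bool)),
  [/\ size rs = 54%N,
      uniq [seq (sqf_collisions (code_mx 5 r), sqf_additive_pairs (code_mx 5 r)) | r <- rs] &
      forall A : 'M[bool]_5, bott_matrix A ->
        exists2 r, r \in rs & affine_equiv (R := R) (code_mx 5 r) A].
Proof.
have cover := @reps_cover R 5 100; move: reps5_invariants cover.
move: (reps 5 100) => rs /andP[/eqP sz un] cover; exists rs; split=> //.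
  rewrite (eq_map (g := fun r => (bits_collisions 5 r, bits_additive_pairs 5 r))) // => r.
  by rewrite bits_collisionsE bits_additive_pairsE.
by move=> A /bott_codesP[c cb ->]; exact: cover.
Qed.

(* Counting the diffeomorphism classes *)
Local Close Scope quotient_scope.
Local Close Scope ring_scope.
Local Close Scope classical_set_scope.

Theorem theoremA (R : realType) :
  #|equivalence_partition
      (fun A B : 'M[bool]_5 =>
         `[< diffeomorphic (@real_bott R 5 A) (@real_bott R 5 B) >])
      [set A : 'M[bool]_5 | bott_matrix A]%SET| = 54.
Proof.
have [rs [size_rs inv_uniq cover_rs]] := reps5_exist R.
set rel := (fun A B : 'M[bool]_5 => _); set D := [set A | _]%SET.
pose rep (i : 'I_54) : 'M[bool]_5 := code_mx 5 (nth [::] rs i).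
pose inv (A : 'M[bool]_5) := (sqf_collisions A, sqf_additive_pairs A).
have rel_inv A B : rel A B -> inv A = inv B.
  by move=> /asboolP/diffeo_sqf_invariants[c p]; rewrite /inv c p.
have rep_inj i j : inv (rep i) = inv (rep j) -> i = j.
  have lt (k : 'I_54) : val k < size rs by rewrite size_rs ltn_ord.
  move=> eq_ij; apply/val_inj/eqP.
  rewrite -(nth_uniq (inv (rep i)) _ _ inv_uniq) ?size_map //.
  by rewrite !(nth_map [::]) //; apply/eqP.
have cover A : A \in D -> exists i, affine_equiv (R := R) (rep i) A.
  rewrite inE => /cover_rs[r rr rA].
  have ir : (index r rs < 54)%N by rewrite -size_rs index_mem.
  by exists (Ordinal ir); rewrite /rep nth_index.
have rep_D i : rep i \in D by rewrite inE code_mx_bott.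
have equiv_rel A B : affine_equiv (R := R) A B -> rel A B.
  by move=> AB; apply/asboolP; exact: affine_equiv_diffeo.
(* The invariants replace transitivity of [rel]: if [B] is related to [A] or to [rep i], its own
   representative has the invariants of [rep i], so it is [rep i], and affine equivalences then
   compose. *)
have relE A B i : affine_equiv (R := R) (rep i) A -> B \in D -> rel A B = rel (rep i) B.
  move=> iA /cover[j jB].
  have ij C : inv C = inv (rep i) -> rel C B -> i = j.
    move=> Ci CB; apply: rep_inj.
    by rewrite -Ci (rel_inv _ _ CB) (rel_inv _ _ (equiv_rel _ _ jB)).
  have Ai : inv A = inv (rep i) by rewrite (rel_inv _ _ (equiv_rel _ _ iA)).
  apply/idP/idP => [/(ij _ Ai) E|/(ij _ erefl) E]; apply: equiv_rel.
    by rewrite E.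
  by apply: affine_equiv_trans (affine_equiv_sym iA) _; rewrite E.
rewrite /equivalence_partition.
pose cls i : {set 'M[bool]_5} := [set B in D | rel (rep i) B]%SET.
have -> : [set [set y in D | rel x y] | x in D]%SET = (cls @: [set: 'I_54])%SET.
  apply/setP => S; apply/imsetP/imsetP => [[A AD ->]|[i _ ->]]; last by exists (rep i).
  have [i iA] := cover A AD; exists i => //.
  by apply/setP => B; rewrite [LHS]inE [RHS]inE; case: (boolP (B \in D)) => //= BD; exact: relE.
(* The 54 classes are distinct: [rep j] lies in its own class, and if it also lies in that of
   [rep i], the invariants give i = j. *)
rewrite card_imset ?cardsT ?card_ord // => i j /setP/(_ (rep j)).
rewrite [LHS]inE [RHS]inE rep_D /= (equiv_rel (rep j)); last exact: affine_equiv_refl.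
by move=> /rel_inv/rep_inj.
Qed.
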